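(* Let $d\ge 1$ be an integer and let $\vartheta>0$ be a real number, both fixed. For any $\alpha>0$ and any $u\in C^{\alpha}$ (the intrinsic Hölder space on $\mathbb{R}\times\mathbb{R}^{2d}$ defined in the context) the following statements are true. (Hölder spaces characterization.) For any $k\in\mathbb{N}_0$ and $\gamma,\beta\in\mathbb{N}_0^d$ with $0\le \vartheta k+(1+\vartheta)|\gamma|+|\beta|<\alpha$, the derivatives $Y^k\partial_v^{\beta}\partial_x^{\gamma}u$ exist and $$\big\|Y^k\partial_v^{\beta}\partial_x^{\gamma}u\big\|_{C^{\alpha-\vartheta k-(1+\vartheta)|\gamma|-|\beta|}}\le \|u\|_{C^{\alpha}}.$$ (Taylor formula.) There exists a positive constant $c$, only dependent on $\alpha$ (with $d$ and $\vartheta$ fixed), and in particular independent of $u$, $z$, $z_0$, such that $$|u(z)-T_{\alpha}u(z_0;z)|\le c\,\|u\|_{C^{\alpha}}\,\|z_0^{-1}\circ z\|^{\alpha},\qquad z,z_0\in\mathbb{R}\times\mathbb{R}^{2d},$$ where, for $z=(t,x,v)$ and $z_0=(t_0,x_0,v_0)$, $$T_{\alpha}u(z_0;z):=\sum_{0\le\vartheta k+(1+\vartheta)|\gamma|+|\beta|<\alpha}\frac{Y^k\partial_v^{\beta}\partial_x^{\gamma}u(z_0)}{k!\,\gamma!\,\beta!}\,(t-t_0)^k\,\big(x-x_0-(t-t_0)v_0\big)^{\gamma}\,(v-v_0)^{\beta},$$ the sum being over $k\in\mathbb{N}_0$ and $\gamma,\beta\in\mathbb{N}_0^d$.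
   Context: Points of $\mathbb{R}\times\mathbb{R}^{2d}$ are written $z=(t,x,v)$ with $t\in\mathbb{R}$, $x,v\in\mathbb{R}^d$. $\mathbb{N}_0$ denotes the non-negative integers; for a multi-index $\beta\in\mathbb{N}_0^d$, $|\beta|=\sum_j\beta_j$, $\beta!=\prod_j\beta_j!$, $x^\beta=\prod_j x_j^{\beta_j}$, $\partial_x^\beta=\partial_{x_1}^{\beta_1}\cdots\partial_{x_d}^{\beta_d}$, and similarly for $\partial_v^\beta$. $a\wedge b$ and $a\vee b$ denote minimum and maximum; $]a,b]$ is the interval open at $a$ and closed at $b$. Vector fields and integral curves: $Z_i:=\partial_{v_i}$ for $i=1,\dots,d$, and $Y:=\langle v,\nabla_x\rangle+\partial_t$. Their integral curves are $e^{\tau Z_i}(t,x,v)=(t,x,v+\tau e_i)$, with $e_i$ the $i$-th canonical basis vector of $\mathbb{R}^d$, and $e^{\tau Y}(t,x,v)=(t+\tau,x+\tau v,v)$, $\tau\in\mathbb{R}$. For $X\in\{Z_1,\dots,Z_d,Y\}$, a function $u$ is $X$-differentiable at $z$ if $\tau\mapsto u(e^{\tau X}(z))$ is differentiable at $\tau=0$, and then the Lie derivative is $Xu(z):=\frac{d}{d\tau}u(e^{\tau X}(z))|_{\tau=0}$. $Y^k$ denotes the $k$-fold iterated Lie derivative along $Y$. Group law and homogeneous norm: $(t_1,x_1,v_1)\circ(t_2,x_2,v_2)=(t_1+t_2,\,x_1+x_2+t_2v_1,\,v_1+v_2)$, with inverse $(t,x,v)^{-1}=(-t,\,tv-x,\,-v)$,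 and $\|(t,x,v)\|=|t|^{1/\vartheta}+|x|^{1/(\vartheta+1)}+|v|$. Hölder regularity along the fields, for $u:\mathbb{R}\times\mathbb{R}^{2d}\to\mathbb{R}$: for $\alpha\in\,]0,1]$, $$\|u\|_{C^\alpha_{Z_i}}:=\sup_{z\in\mathbb{R}\times\mathbb{R}^{2d},\ \tau\in\mathbb{R}\setminus\{0\}}\frac{|u(e^{\tau Z_i}(z))-u(z)|}{|\tau|^\alpha},$$ and for $\alpha\in\,]0,\vartheta]$, $$\|u\|_{C^\alpha_Y}:=\sup_{z\in\mathbb{R}\times\mathbb{R}^{2d},\ \tau\in\mathbb{R}\setminus\{0\}}\frac{|u(e^{\tau Y}(z))-u(z)|}{|\tau|^{\alpha/\vartheta}};$$ $u\in C^\alpha_{Z_i}$ (resp. $C^\alpha_Y$) means that the corresponding quantity is finite. Intrinsic Hölder spaces $C^\alpha$, $\alpha>0$, are defined recursively: $u\in C^\alpha$ if the following semi-norm is finite (which includes the existence everywhere of the Lie derivatives appearing in it): (i) if $\alpha\in\,]0,1\wedge\vartheta]$: $\|u\|_{C^\alpha}:=\|u\|_{C^\alpha_Y}+\sum_{i=1}^d\|u\|_{C^\alpha_{Z_i}}$; (ii) if $\alpha\in\,]1\wedge\vartheta,1\vee\vartheta]$ (empty when $\vartheta=1$): $\|u\|_{C^\alpha}:=\|Yu\|_{C^{\alpha-\vartheta}}+\sum_{i=1}^d\|u\|_{C^\alpha_{Z_i}}$ if $\vartheta<1$, and $\|u\|_{C^\alpha}:=\|u\|_{C^\alpha_Y}+\sum_{i=1}^d\|Z_iu\|_{C^{\alpha-1}}$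 if $\vartheta>1$; (iii) if $\alpha>1\vee\vartheta$: $\|u\|_{C^\alpha}:=\|Yu\|_{C^{\alpha-\vartheta}}+\sum_{i=1}^d\|Z_iu\|_{C^{\alpha-1}}$. *)

(* Defs.v *)
From HB Require Import structures.
From mathcomp Require Import all_boot all_order all_algebra.
From mathcomp Require Import all_classical all_reals all_analysis.
From mathcomp Require Import lra.

Set Implicit Arguments.
Unset Strict Implicit.
Unset Printing Implicit Defensive.

Import Order.TTheory GRing.Theory Num.Theory.
Import numFieldNormedType.Exports.

Local Open Scope classical_set_scope.
Local Open Scope ring_scope.

Notation spacetime R d := (R * 'rV[R]_d * 'rV[R]_d)%type.

(* The integral curves [tau |-> e^(tau X) z] of a vector field X. *)
Notation flow R d := (R -> spacetime R d -> spacetime R d).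

Definition flowY (R : realType) (d : nat) : flow R d :=
  fun tau z => let: (t, x, v) := z in (t + tau, x + tau *: v, v).

Definition flowZ (R : realType) (d : nat) (i : 'I_d) : flow R d :=
  fun tau z => let: (t, x, v) := z in (t, x, v + tau *: delta_mx 0 i).

Definition flowX (R : realType) (d : nat) (i : 'I_d) : flow R d :=
  fun tau z => let: (t, x, v) := z in (t, x + tau *: delta_mx 0 i, v).

Arguments flowY {R d} tau z.
Arguments flowZ {R d} i tau z.
Arguments flowX {R d} i tau z.

Definition lie_derivable (R : realType) (d : nat) (X : flow R d)
    (u : spacetime R d -> R) : Prop :=
  forall z, derivable (fun tau : R => u (X tau z)) 0 1.

Definition lie (R : realType) (d : nat) (X : flow R d)
    (u : spacetime R d -> R) : spacetime R d -> R :=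
  fun z => derive1 (fun tau : R => u (X tau z)) 0.

(* Iterated derivatives along a word of fields; as in operator notation, the
   last letter of the word is applied first. *)
Definition lies (R : realType) (d : nat) (s : seq (flow R d))
    (u : spacetime R d -> R) : spacetime R d -> R :=
  foldr (@lie R d) u s.

Fixpoint lies_exist (R : realType) (d : nat) (s : seq (flow R d))
    (u : spacetime R d -> R) : Prop :=
  if s is X :: s' then lies_exist s' u /\ lie_derivable X (lies s' u)
  else True.

Notation multi_index d := {ffun 'I_d -> nat}.

Definition mi_size (d : nat) (b : multi_index d) : nat := (\sum_j b j)%N.

Definition mi_fact (d : nat) (b : multi_index d) : nat := (\prod_j (b j)`!)%N.

Definition mi_pow (R : realType) (d : nat) (x : 'rV[R]_d) (b : multi_index d)
  : R := \prod_j x 0 j ^+ b j.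

Definition mi_word (R : realType) (d : nat) (X : 'I_d -> flow R d)
    (b : multi_index d) : seq (flow R d) :=
  flatten [seq nseq (b j) (X j) | j <- enum 'I_d].

(* The operator Y^k d_v^beta d_x^gamma. *)
Definition deriv_word (R : realType) (d : nat) (k : nat)
    (gamma beta : multi_index d) : seq (flow R d) :=
  nseq k flowY ++ mi_word flowZ beta ++ mi_word flowX gamma.

Arguments deriv_word R {d} k gamma beta.

Definition hdegree (R : realType) (d : nat) (theta : R) (k : nat)
    (gamma beta : multi_index d) : R :=
  theta * k%:R + (1 + theta) * (mi_size gamma)%:R + (mi_size beta)%:R.

Definition gmul (R : realType) (d : nat) (z1 z2 : spacetime R d) : spacetime R d :=
  let: (t1, x1, v1) := z1 in
  let: (t2, x2, v2) := z2 in
  (t1 + t2, x1 + x2 + t2 *: v1, v1 + v2).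

Definition ginv (R : realType) (d : nat) (z : spacetime R d) : spacetime R d :=
  let: (t, x, v) := z in (- t, t *: v - x, - v).

(* The library norm on row vectors is the sup norm, hence this definition. *)
Definition eucl (R : realType) (d : nat) (x : 'rV[R]_d) : R :=
  Num.sqrt (\sum_j x 0 j ^+ 2).

Definition hom_norm (R : realType) (d : nat) (theta : R) (z : spacetime R d) : R :=
  let: (t, x, v) := z in
  `|t| `^ (1 / theta) + eucl x `^ (1 / (theta + 1)) + eucl v.

Definition curve_seminorm (R : realType) (d : nat) (X : flow R d) (a : R)
    (u : spacetime R d -> R) : \bar R :=
  ereal_sup [set (`|u (X tau z) - u z| / `|tau| `^ a)%:E
            | z in [set: spacetime R d] & tau in [set tau : R | tau != 0]].

Definition normZ (R : realType) (d : nat) (i : 'I_d) (alpha : R)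
    (u : spacetime R d -> R) : \bar R :=
  curve_seminorm (flowZ i) alpha u.

Definition normY (R : realType) (d : nat) (theta alpha : R)
    (u : spacetime R d -> R) : \bar R :=
  curve_seminorm flowY (alpha / theta) u.

(* [N a (X u)], infinite when the Lie derivative X u fails to exist somewhere. *)
Definition norm_lie (R : realType) (d : nat)
    (N : R -> (spacetime R d -> R) -> \bar R) (X : flow R d) (a : R)
    (u : spacetime R d -> R) : \bar R :=
  if `[< lie_derivable X u >] then N a (lie X u) else +oo%E.

(* The recursive definition of the intrinsic seminorm of order alpha, in terms
   of the seminorms N of the smaller orders alpha - theta and alpha - 1. *)
Definition holder_step (R : realType) (d : nat) (theta : R)
    (N : R -> (spacetime R d -> R) -> \bar R) (alpha : R) (u : spacetime R d -> R)
  : \bar R :=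
  if alpha <= Num.min 1 theta then
    (normY theta alpha u + \sum_i normZ i alpha u)%E
  else if alpha <= Num.max 1 theta then
    if theta < 1 then
      (norm_lie N flowY (alpha - theta)%R u + \sum_i normZ i alpha u)%E
    else
      (normY theta alpha u + \sum_i norm_lie N (flowZ i) (alpha - 1)%R u)%E
  else
    (norm_lie N flowY (alpha - theta)%R u
       + \sum_i norm_lie N (flowZ i) (alpha - 1)%R u)%E.

(* Every recursive call decreases alpha by at least [min 1 theta], so the
   number of unfoldings below suffices for alpha > 0: see [holder_normE]. *)
Definition holder_norm (R : realType) (d : nat) (theta alpha : R)
    (u : spacetime R d -> R) : \bar R :=
  iter (Num.truncn (alpha / Num.min 1 theta)).+1 (holder_step theta)
    (fun _ _ => +oo%E) alpha u.

Definition holder (R : realType) (d : nat) (theta alpha : R)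
    (u : spacetime R d -> R) : Prop :=
  holder_norm theta alpha u \is a fin_num.

Definition taylor (R : realType) (d : nat) (theta alpha : R)
    (u : spacetime R d -> R) (z0 z : spacetime R d) : R :=
  let: (t, x, v) := z in
  let: (t0, x0, v0) := z0 in
  \sum_(m \in [set m : nat * multi_index d * multi_index d |
                hdegree theta m.1.1 m.1.2 m.2 < alpha])
    let: (k, gamma, beta) := m in
    lies (deriv_word R k gamma beta) u z0
      / (k`! * mi_fact gamma * mi_fact beta)%:R
      * (t - t0) ^+ k * mi_pow (x - x0 - (t - t0) *: v0) gamma
      * mi_pow (v - v0) beta.

Lemma holder_step_ext (R : realType) (d : nat) (theta : R)
    (N N' : R -> (spacetime R d -> R) -> \bar R) (alpha : R)
    (u : spacetime R d -> R) :
  (forall w, theta < alpha -> N (alpha - theta) w = N' (alpha - theta) w) ->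
  (forall w, 1 < alpha -> N (alpha - 1) w = N' (alpha - 1) w) ->
  holder_step theta N alpha u = holder_step theta N' alpha u.
Proof.
move=> NY NZ.
have eqY : theta < alpha ->
    norm_lie N flowY (alpha - theta) u = norm_lie N' flowY (alpha - theta) u.
  by move=> h; rewrite /norm_lie NY.
have eqZ i : 1 < alpha ->
    norm_lie N (flowZ i) (alpha - 1) u = norm_lie N' (flowZ i) (alpha - 1) u.
  by move=> h; rewrite /norm_lie NZ.
rewrite /holder_step; case: (leP alpha (Num.min 1 theta)) => // hmin.
case: (leP alpha (Num.max 1 theta)) => [_|].
  case: (ltP theta 1) => h1.
    by rewrite eqY// (le_lt_trans _ hmin)// le_min lexx ltW.
  congr (_ + _)%E; apply: eq_bigr => i _; rewrite eqZ//.
  by rewrite (le_lt_trans _ hmin)// le_min lexx.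
rewrite gt_max => /andP[h1 htheta]; rewrite eqY//.
by congr (_ + _)%E; apply: eq_bigr => i _; rewrite eqZ.
Qed.

Lemma holder_normE (R : realType) (d : nat) (theta alpha : R)
    (u : spacetime R d -> R) : 0 < theta -> 0 < alpha ->
  holder_norm theta alpha u = holder_step theta (holder_norm theta) alpha u.
Proof.
move=> theta0 alpha0; set m := Num.min 1 theta.
have m0 : 0 < m by rewrite lt_min ltr01.
have [m1 mtheta] : m <= 1 /\ m <= theta by rewrite /m !ge_min !lexx orbT.
pose it n := iter n (@holder_step R d theta) (fun _ _ => +oo%E).
have indep n p a w : 0 < a -> a < n%:R * m -> a < p%:R * m ->
    it n a w = it p a w.
  elim: n p a w => [|n IH] [|p] a w a0; rewrite ?mul0r => an ap.
  - by [].
  - by have := lt_trans a0 an; rewrite ltxx.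
  - by have := lt_trans a0 ap; rewrite ltxx.
  move: an ap; rewrite -!natr1 !mulrDl !mul1r => an ap.
  by apply: holder_step_ext => w' h; apply: IH; lra.
have fuel a : a < (Num.truncn (a / m)).+1%:R * m.
  by rewrite -ltr_pdivrMr// truncnS_gt.
rewrite {1}/holder_norm iterS; apply: holder_step_ext => w h.
  rewrite /holder_norm -!/(it _); apply: indep; last exact: fuel.
    by lra.
  by have := fuel alpha; rewrite -natr1 mulrDl mul1r; lra.
rewrite /holder_norm -!/(it _); apply: indep; last exact: fuel.
  by lra.
by have := fuel alpha; rewrite -natr1 mulrDl mul1r; lra.
Qed.

(* The library's sum over a set is 0 by convention when infinitely many terms
   are nonzero; this rules out that case in [taylor]. *)
Lemma finite_taylor_index (R : realType) (d : nat) (theta alpha : R) :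
  0 < theta ->
  finite_set [set m : nat * multi_index d * multi_index d |
               hdegree theta m.1.1 m.1.2 m.2 < alpha].
Proof.
move=> theta0.
pose n := (Num.truncn (alpha / theta)).+1.
pose q := (Num.truncn alpha).+1.
have nP : alpha < theta * n%:R.
  by rewrite mulrC -ltr_pdivrMr// truncnS_gt.
have qP : alpha < q%:R by exact: truncnS_gt.
pose I := ('I_n * {ffun 'I_d -> 'I_q} * {ffun 'I_d -> 'I_q})%type.
pose f (m : I) : nat * multi_index d * multi_index d :=
  (val m.1.1, [ffun j => val (m.1.2 j)], [ffun j => val (m.2 j)]).
apply: (@sub_finite_set _ _ (f @` setT)); last first.
  by apply: finite_image; exact: finite_finset.
move=> [[k g] b] /=; rewrite /hdegree => hlt.
have k0 : 0 <= k%:R :> R by exact: ler0n.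
have g0 : 0 <= (mi_size g)%:R :> R by exact: ler0n.
have b0 : 0 <= (mi_size b)%:R :> R by exact: ler0n.
have kg0 : 0 <= theta * k%:R by rewrite mulr_ge0// ltW.
have tg0 : 0 <= theta * (mi_size g)%:R by rewrite mulr_ge0// ltW.
move: hlt; rewrite mulrDl mul1r => hlt.
have kn : (k < n)%N.
  by rewrite -(ltr_nat R) -(ltr_pM2l theta0); lra.
have small (c : multi_index d) j : (mi_size c)%:R < q%:R :> R -> (c j < q)%N.
  rewrite ltr_nat; apply: leq_ltn_trans.
  by rewrite /mi_size (bigD1 j)//= leq_addr.
have gq j : (g j < q)%N by apply: small; lra.
have bq j : (b j < q)%N by apply: small; lra.
exists (Ordinal kn, [ffun j => Ordinal (gq j)], [ffun j => Ordinal (bq j)]) => //.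
by rewrite /f /=; congr (_, _, _); apply/ffunP => j; rewrite !ffunE.
Qed.

(* Main.v *)
Require Import Defs.
From HB Require Import structures.
From mathcomp Require Import all_boot all_order all_algebra.
From mathcomp Require Import all_classical all_reals all_analysis.
From mathcomp Require Import ring lra.

Import Order.TTheory GRing.Theory Num.Theory.
Import numFieldNormedType.Exports.

Set Implicit Arguments.
Unset Strict Implicit.
Unset Printing Implicit Defensive.

Local Open Scope classical_set_scope.
Local Open Scope ring_scope.

(** The fields Y and Z_i have weights theta and 1, and the translation along
    x_i, written X_i below, is their bracket and gets the weight 1 + theta. The
    proof shows that, seen from the intrinsic seminorms, X_i behaves like the
    given fields: for each of the three kinds of field F, of weight w,
    - if w < a, then every u in C^a has a Lie derivative F u, and its seminorm
      of order a - w is at most the seminorm of order a of u;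
    - if a <= w, then u in C^a is Hoelder continuous of exponent a / w along
      the integral curves of F.
    A field with these two properties is called graded below. For Y and Z_i they
    are part of the definition of the seminorm; once X_i has them too, the first
    one, applied letter by letter, is the statement on the derivatives.

    For X_i both properties come from the parallelogram with sides s along Z_i
    and r along Y, which fails to close up by exactly r * s in the direction
    x_i. With s = rho and r = +- rho ^ theta, the increment of u along x_i over
    a time of size rho ^ (1 + theta) is a sum of two differences of increments,
    along Z_i and along Y, over opposite sides ([commutator_increment]). By the
    mean value theorem these are increments of Z_i u and Y u between nearby
    points, and those functions have the orders a - 1 and a - theta.
    - For a <= 1 + theta, an induction on the order bounds them by
      rho ^ a ([curve_holder_flowX]).
    - For a > 1 + theta, the Taylor expansions of Z_i u and Y u along Y, Z_i and
      X_i isolate the terms - r * s * Y Z_i u and r * s * Z_i Y u, up to an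
      error that is negligible with respect to rho ^ (1 + theta), because the
      next homogeneous degree is larger by at least min(1, theta)
      ([is_derive_flowX]). So X_i u exists and equals Z_i Y u - Y Z_i u. These
      two functions are controlled by two different summands of the seminorm of
      u, whence the constant 1 ([lowers_flowX]). The expansions involve X_i only
      at smaller orders, so this too is an induction on the order.

    Taylor's formula holds for any list of graded fields ([taylor_along]): the
    one-dimensional formula along a single curve ([taylor_one_field]) is applied
    to one field after the other. Going from z0 first along Y, then along
    Z_1, .., Z_d and at last along X_1, .., X_d reaches every point z, with
    times that are the coordinates of the increment of z with respect to z0 for
    the group law ([travel_all_steps]); expanding in the reverse order
    differentiates along x first, then along v, then along Y, which gives the
    Taylor polynomial of the theorem ([taylor_box]). *)

(** * Calculus in one variable *)

Section Calculus.
Variable R : realType.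
Implicit Types (h : R -> R).

(** Bounds on a Lie derivative are passed on to the function through this
    inequality, in the role that integration has in the usual proof of Taylor's
    formula. *)
Lemma mean_value_bound h (dh : R -> R) (c E s : R) :
  (forall x, is_derive x (1 : R) h (dh x)) ->
  (forall x, `|x| <= `|s| -> `|dh x - c| <= E) ->
  `|h s - h 0 - c * s| <= E * `|s|.
Proof.
move=> dhE bnd.
have cont a b : {within `[a, b], continuous h}.
  apply: derivable_within_continuous => x _.
  exact: (@ex_derive _ _ _ _ _ _ _ (dhE x)).
have [s0|s0] := leP 0 s.
  have [x] := MVT_segment s0 (fun x _ => dhE x) (cont _ _).
  rewrite in_itv/= subr0 => /andP[x0 xs] ->.
  rewrite -mulrBl normrM ler_wpM2r//; apply: bnd.
  by rewrite !ger0_norm.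
have [x] := MVT_segment (ltW s0) (fun x _ => dhE x) (cont _ _).
rewrite in_itv/= => /andP[xs x0] hE.
have -> : h s - h 0 - c * s = (dh x - c) * s by rewrite mulrBl; lra.
rewrite normrM ler_wpM2r//; apply: bnd.
by rewrite !ler0_norm ?lerN2// ltW.
Qed.

Lemma derivative_from_bound h (W C e : R) : 0 < e ->
  (forall s, `|s| <= 1 -> `|h s - h 0 - W * s| <= C * (`|s| * `|s| `^ e)) ->
  is_derive (0 : R) (1 : R) h W.
Proof.
move=> e0 bnd.
suff cv : (fun s => s^-1 *: ((h \o shift 0) (s *: (1 : R)) - h 0)) @ 0^' --> W.
  apply: DeriveDef; first by apply/cvg_ex; exists W.
  exact: cvg_lim cv.
have C0 : 0 <= C.
  have := bnd 1; rewrite normr1 powR1 !mulr1 => /(_ (lexx _)).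
  exact: le_trans.
apply/cvgrPdist_le => eps eps0.
pose del := Num.min 1 ((eps / (C + 1)) `^ e^-1).
have C1 : 0 < C + 1 by lra.
have del0 : 0 < del by rewrite lt_min ltr01 powR_gt0 ?divr_gt0.
near=> s.
have s0 : s != 0 by near: s; exact: nbhs_dnbhs_neq.
have sd : `|s| <= del.
  near: s; apply/nbhs_ballP; exists del => //= x.
  by rewrite /ball/= sub0r normrN => /ltW.
rewrite /= addr0 [s *: 1]mulr1.
have s1 : `|s| <= 1 by rewrite (le_trans sd)// /del ge_min lexx.
have -> : W - s^-1 *: (h s - h 0) = - ((h s - h 0 - W * s) / s).
  by rewrite /GRing.scale/=; field.
rewrite normrN (normrM (h s - h 0 - W * s)) normfV ler_pdivrMr ?normr_gt0//.
apply: le_trans (bnd s s1) _.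
rewrite mulrCA mulrC ler_wpM2r//.
have : `|s| `^ e <= eps / (C + 1).
  have -> : eps / (C + 1) = ((eps / (C + 1)) `^ e^-1) `^ e.
    by rewrite -powRrM mulVf ?gt_eqF// powRr1// ltW// divr_gt0.
  apply: ge0_ler_powR; rewrite ?nnegrE ?powR_ge0// ?(ltW e0)//.
  by rewrite (le_trans sd)// /del ge_min lexx orbT.
rewrite ler_pdivlMr// => le1.
have : C * `|s| `^ e <= `|s| `^ e * (C + 1).
  by rewrite mulrC ler_wpM2l ?powR_ge0//; lra.
lra.
Unshelve. all: by end_near. Qed.

Lemma powRS (x p : R) : 0 <= x -> 0 < p -> x `^ p * x = x `^ (p + 1).
Proof.
move=> x0 p0; rewrite -(mulr_powRB1 x0 (p := p + 1)) ?addrK 1?mulrC//; lra.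
Qed.

Lemma powRD_ge0 (x p q : R) : 0 <= p -> 0 <= q -> x `^ (p + q) = x `^ p * x `^ q.
Proof.
move=> p0 q0; have [pq|pq] := eqVneq (p + q) 0; last by rewrite powRD// (negbTE pq).
have [-> ->] : p = 0 /\ q = 0 by split; lra.
by rewrite addr0 !powRr0 mulr1.
Qed.

End Calculus.

(** * Differentiation along a flow *)

Section Flows.
Variables (R : realType) (d : nat).
Implicit Types (F : flow R d) (u : spacetime R d -> R) (z : spacetime R d).

Definition flow_law F :=
  (forall z, F 0 z = z) /\ (forall s t z, F (s + t) z = F s (F t z)).

Lemma flow_lawY : flow_law flowY.
Proof.
split=> [[[t x] v]|s r [[t x] v]] /=; first by rewrite addr0 scale0r addr0.
by rewrite [s + r]addrC addrA scalerDl addrA.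
Qed.

Lemma flow_lawZ i : flow_law (flowZ i).
Proof.
split=> [[[t x] v]|s r [[t x] v]] /=; first by rewrite scale0r addr0.
by rewrite [s + r]addrC scalerDl addrA.
Qed.

Lemma flow_lawX i : flow_law (flowX i).
Proof.
split=> [[[t x] v]|s r [[t x] v]] /=; first by rewrite scale0r addr0.
by rewrite [s + r]addrC scalerDl addrA.
Qed.

Lemma is_derive_lie F u z : lie_derivable F u ->
  is_derive (0 : R) (1 : R) (fun s => u (F s z)) (lie F u z).
Proof. by move=> /(_ z) Fu; rewrite /lie derive1E; exact: derivableP. Qed.

Lemma is_derive_lieE F u w :
  (forall z, is_derive (0 : R) (1 : R) (fun s => u (F s z)) (w z)) ->
  lie_derivable F u /\ lie F u = w.
Proof.
move=> Fu; split=> [z|]; first exact: (@ex_derive _ _ _ _ _ _ _ (Fu z)).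
by apply/funext => z; rewrite /lie derive1E (@derive_val _ _ _ _ _ _ _ (Fu z)).
Qed.

Lemma is_derive_flow F u z (s : R) : flow_law F -> lie_derivable F u ->
  is_derive s (1 : R) (fun t => u (F t z)) (lie F u (F s z)).
Proof.
move=> [F0 FD] Fu.
have -> : (fun t => u (F t z)) = (fun t => u (F t (F s z))) \o (shift (- s)).
  by apply/funext => t /=; rewrite -FD subrK.
rewrite -[lie F u _]mulr1; apply: is_derive1_comp.
  by rewrite /= subrr; exact: is_derive_lie.
exact: is_derive_shift.
Qed.

End Flows.

(** * The intrinsic seminorms *)

Section Seminorms.
Variables (R : realType) (d : nat) (theta : R).
Hypothesis theta0 : 0 < theta.
Implicit Types (F : flow R d) (u f g : spacetime R d -> R).
Implicit Types (N : R -> (spacetime R d -> R) -> \bar R).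
Local Notation hn := (holder_norm theta).

Lemma curve_seminorm_ub F a u z (tau : R) : tau != 0 ->
  ((`|u (F tau z) - u z| / `|tau| `^ a)%:E <= curve_seminorm F a u)%E.
Proof. by move=> tau0; apply: ereal_sup_ubound; exists z => //; exists tau. Qed.

Lemma curve_seminorm_ge0 F a u : (0 <= curve_seminorm F a u)%E.
Proof.
apply: le_trans (curve_seminorm_ub F a u 0 (oner_neq0 R)).
by rewrite lee_fin divr_ge0 ?powR_ge0.
Qed.

Lemma norm_lie_ge0 N F a u : (forall b w, (0 <= N b w)%E) ->
  (0 <= norm_lie N F a u)%E.
Proof. by move=> N0; rewrite /norm_lie; case: ifP. Qed.

(* Induction on the number of unfoldings of the recursive definition needs no
   case distinction on the order. *)
Let Nk n : R -> (spacetime R d -> R) -> \bar R :=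
  iter n (holder_step theta) (fun _ _ => +oo%E).

Let NkS n a u : Nk n.+1 a u = holder_step theta (Nk n) a u.
Proof. by []. Qed.

Let Nk_ge0 n a u : (0 <= Nk n a u)%E.
Proof.
elim: n a u => [|n IH] a u; first exact: leey.
rewrite NkS /holder_step.
have L0 F b := norm_lie_ge0 F b _ IH.
case: (a <= Num.min 1 theta); [|case: (a <= Num.max 1 theta);
  [case: (theta < 1)|]];
  (apply: adde_ge0; last apply: sume_ge0 => i _);
  lazymatch goal with
  |- context [norm_lie] => exact: L0 | _ => exact: curve_seminorm_ge0 end.
Qed.

Lemma holder_norm_ge0 a u : (0 <= hn a u)%E.
Proof. exact: (Nk_ge0 (Num.truncn (a / Num.min 1 theta)).+1). Qed.

Lemma lie_derivableB F f g : lie_derivable F f -> lie_derivable F g ->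
  lie_derivable F (f \- g) /\ lie F (f \- g) = lie F f \- lie F g.
Proof.
move=> Ff Fg; apply: is_derive_lieE => z.
by apply: is_deriveB; exact: is_derive_lie.
Qed.

Lemma curve_seminormB F a f g :
  (curve_seminorm F a (f \- g)%R <= curve_seminorm F a f + curve_seminorm F a g)%E.
Proof.
apply: ge_ereal_sup => _ [z _] [tau tau0 <-].
have := curve_seminorm_ub F a f z tau0; have := curve_seminorm_ub F a g z tau0.
move=> bg bf; apply: le_trans (leeD bf bg); rewrite -EFinD lee_fin -mulrDl.
rewrite ler_wpM2r ?invr_ge0 ?powR_ge0//.
have -> : (f \- g) (F tau z) - (f \- g) z =
    (f (F tau z) - f z) - (g (F tau z) - g z) by rewrite /=; ring.
exact: ler_normB.
Qed.

Lemma norm_lieT N F a u : lie_derivable F u ->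
  norm_lie N F a u = N a (lie F u).
Proof. by move=> Fu; rewrite /norm_lie (asboolT Fu). Qed.

Lemma norm_lieN N F a u : ~ lie_derivable F u -> norm_lie N F a u = +oo%E.
Proof. by move=> Fu; rewrite /norm_lie (asboolF Fu). Qed.

Lemma norm_lieB N F a f g : (forall b w, (0 <= N b w)%E) ->
  (forall b w w', (N b (w \- w')%R <= N b w + N b w')%E) ->
  (norm_lie N F a (f \- g)%R <= norm_lie N F a f + norm_lie N F a g)%E.
Proof.
move=> N0 NB; have neqNy (x : \bar R) : (0 <= x)%E -> x != -oo%E by case: x.
have [Ff|nFf] := pselect (lie_derivable F f); last first.
  rewrite (norm_lieN _ _ nFf) addye; first exact: leey.
  by apply: neqNy; exact: norm_lie_ge0.
have [Fg|nFg] := pselect (lie_derivable F g); last first.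
  rewrite (norm_lieN _ _ nFg) addey; first exact: leey.
  by apply: neqNy; exact: norm_lie_ge0.
have [FB FBE] := lie_derivableB Ff Fg.
rewrite (norm_lieT _ _ Ff) (norm_lieT _ _ Fg) (norm_lieT _ _ FB) FBE.
exact: NB.
Qed.

Let Nk_sub n a f g : (Nk n a (f \- g)%R <= Nk n a f + Nk n a g)%E.
Proof.
elim: n a f g => [|n IH] a f g; first exact: leey.
rewrite !NkS.
have sub2 (A B C : \bar R) (D E G : 'I_d -> \bar R) :
    (A <= B + C -> (forall i, D i <= E i + G i) ->
     A + \sum_i D i <= (B + \sum_i E i) + (C + \sum_i G i))%E.
  move=> AB DE; rewrite addeACA -big_split/=.
  by apply: leeD => //; apply: lee_sum => i _.
have LB F b := norm_lieB F b f g (@Nk_ge0 n) IH.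
rewrite /holder_step; case: (a <= Num.min 1 theta); [|case: (a <= Num.max 1 theta);
  [case: (theta < 1)|]].
- exact: (sub2 _ _ _ _ _ _ (curve_seminormB flowY (a / theta) f g)
    (fun i => curve_seminormB (flowZ i) a f g)).
- exact: (sub2 _ _ _ _ _ _ (LB flowY (a - theta))
    (fun i => curve_seminormB (flowZ i) a f g)).
- exact: (sub2 _ _ _ _ _ _ (curve_seminormB flowY (a / theta) f g)
    (fun i => LB (flowZ i) (a - 1))).
- exact: (sub2 _ _ _ _ _ _ (LB flowY (a - theta))
    (fun i => LB (flowZ i) (a - 1))).
Qed.

Lemma holder_normB a f g : (hn a (f \- g)%R <= hn a f + hn a g)%E.
Proof. exact: (Nk_sub (Num.truncn (a / Num.min 1 theta)).+1). Qed.

Let hn0 := holder_norm_ge0.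
Let sumZ_ge0 a u : (0 <= \sum_(i < d) normZ i a u)%E.
Proof. by apply: sume_ge0 => i _; exact: curve_seminorm_ge0. Qed.
Let sumL_ge0 a u : (0 <= \sum_(i < d) norm_lie hn (flowZ i) a u)%E.
Proof. by apply: sume_ge0 => i _; exact: norm_lie_ge0. Qed.
Let lee_sum1 (E : 'I_d -> \bar R) i :
  (forall j, (0 <= E j)%E) -> (E i <= \sum_j E j)%E.
Proof. by move=> E0; rewrite (bigD1 i)//= leeDl// sume_ge0. Qed.

Lemma norm_lieY_le a u : theta < a ->
  (norm_lie hn flowY (a - theta)%R u <= hn a u)%E.
Proof.
move=> ta; rewrite holder_normE//; last exact: lt_trans ta.
rewrite /holder_step ifF; last by apply/negbTE; rewrite -ltNge gt_min ta orbT.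
case: ifP => [am|_]; last by rewrite leeDl.
case: ifP => [t1|/negbT]; first by rewrite leeDl.
rewrite -leNgt => t1; exfalso; move: am; rewrite le_max => /orP[]; lra.
Qed.

Lemma norm_lieZ_le a u i : 1 < a ->
  (norm_lie hn (flowZ i) (a - 1)%R u <= hn a u)%E.
Proof.
move=> a1; rewrite holder_normE//; last exact: lt_trans a1.
rewrite /holder_step ifF; last by apply/negbTE; rewrite -ltNge gt_min a1.
have L := lee_sum1 i (fun j => norm_lie_ge0 (flowZ j) (a - 1) u hn0).
case: ifP => [am|_]; last by rewrite (le_trans L)// leeDr// norm_lie_ge0.
case: ifP => [t1|_].
  by exfalso; move: am; rewrite le_max => /orP[]; lra.
by rewrite (le_trans L)// leeDr// curve_seminorm_ge0.
Qed.

(** Both summands at once: this is what bounds a bracket of Y and Z_i by the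
    seminorm itself and not by twice the seminorm. *)
Lemma norm_lieYZ_le a u i : 1 < a -> theta < a ->
  (norm_lie hn flowY (a - theta)%R u + norm_lie hn (flowZ i) (a - 1)%R u <= hn a u)%E.
Proof.
move=> a1 ta; rewrite [X in (_ <= X)%E]holder_normE//; last exact: lt_trans a1.
rewrite /holder_step ifF; last by apply/negbTE; rewrite -ltNge gt_min a1.
rewrite ifF; last by apply/negbTE; rewrite -ltNge gt_max a1.
by rewrite leeD2l// (lee_sum1 i (fun j => norm_lie_ge0 (flowZ j) (a - 1) u hn0)).
Qed.

Lemma normY_le a u : 0 < a <= theta -> (normY theta a u <= hn a u)%E.
Proof.
move=> /andP[a0 ta]; rewrite holder_normE// /holder_step.
case: ifP => [_|/negbT]; first by rewrite leeDl.
rewrite -ltNge gt_min => am; rewrite le_max ta orbT ifF.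
  by rewrite leeDl.
by apply/negbTE; rewrite -leNgt; case/orP: am; lra.
Qed.

Lemma normZ_le a u i : 0 < a <= 1 -> (normZ i a u <= hn a u)%E.
Proof.
move=> /andP[a0 a1]; rewrite holder_normE// /holder_step.
have L := lee_sum1 i (fun j => curve_seminorm_ge0 (flowZ j) a u).
case: ifP => [_|/negbT]; first by rewrite (le_trans L)// leeDr// curve_seminorm_ge0.
rewrite -ltNge gt_min => am; rewrite le_max a1 ifT.
  by rewrite (le_trans L)// leeDr// norm_lie_ge0.
by case/orP: am; lra.
Qed.

Lemma curve_seminorm_bound F a u B z (tau : R) : flow_law F -> 0 < a ->
  (curve_seminorm F a u <= B%:E)%E -> `|u (F tau z) - u z| <= B * `|tau| `^ a.
Proof.
move=> [F0 _] a0 uB; have [->|tau0] := eqVneq tau 0.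
  by rewrite F0 subrr !normr0 powR0 ?mulr0 ?gt_eqF.
rewrite -ler_pdivrMr ?powR_gt0 ?normr_gt0// -lee_fin.
exact: le_trans (curve_seminorm_ub _ _ _ _ tau0) uB.
Qed.

Lemma norm_lie_finite F a u B : (norm_lie hn F a u <= B%:E)%E ->
  lie_derivable F u /\ (hn a (lie F u) <= B%:E)%E.
Proof. by rewrite /norm_lie; case: asboolP. Qed.

End Seminorms.

(** * Taylor's formula along graded fields *)

Section Graded.
Variables (R : realType) (d : nat) (theta : R).
Implicit Types (F : flow R d) (u : spacetime R d -> R) (z : spacetime R d).
Implicit Types (A K B a w rho : R).
Local Notation hn := (holder_norm theta).

(** The bound A on the orders allows an induction in which X_i is known to have
    this property only up to A. *)
Definition lowers (A : R) F (w : R) := forall a u B, a <= A -> w < a ->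
  (hn a u <= B%:E)%E ->
  lie_derivable F u /\ (hn (a - w) (lie F u) <= B%:E)%E.

Definition curve_holder (K : R) F (w : R) := forall a u B, 0 < a <= w ->
  (hn a u <= B%:E)%E ->
  forall z tau, `|u (F tau z) - u z| <= K * B * `|tau| `^ (a / w).

Definition graded (A K : R) F (w : R) :=
  [/\ 0 < w, flow_law F, lowers A F w & 0 <= K /\ curve_holder K F w].

Lemma holder_bound_ge0 a u B : (hn a u <= B%:E)%E -> 0 <= B.
Proof. by rewrite -lee_fin; apply: le_trans; exact: holder_norm_ge0. Qed.

Lemma lies_nseq n F u : lies (nseq n F) u = iter n (lie F) u.
Proof. by elim: n => [//|n IH]; rewrite /= IH. Qed.

Lemma lies_cat (s t : seq (flow R d)) u : lies (s ++ t) u = lies s (lies t u).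
Proof. exact: foldr_cat. Qed.

Lemma lies_exist_cat (s t : seq (flow R d)) u : lies_exist t u ->
  lies_exist s (lies t u) -> lies_exist (s ++ t) u.
Proof.
move=> tu; elim: s => [_|F s IH [su Fu]]; first exact: tu.
split; first exact: IH.
by rewrite lies_cat.
Qed.

Lemma lies_nseq_bound A F w n a u B : lowers A F w -> 0 < w ->
  a <= A -> w * n%:R < a -> (hn a u <= B%:E)%E ->
  lies_exist (nseq n F) u /\ (hn (a - w * n%:R) (lies (nseq n F) u) <= B%:E)%E.
Proof.
move=> Fw w0 aA; elim: n => [|n IH] na uB; first by rewrite mulr0 subr0.
move: na; rewrite -natr1 mulrDr mulr1 => na.
have [|ex le] := IH _ uB; first lra.
have wn0 : 0 <= w * n%:R by rewrite mulr_ge0// ltW.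
have [||Fu Fle] := Fw _ _ _ _ _ le; [by lra..|].
by split; [split|rewrite opprD addrA].
Qed.

Lemma is_derive_monomial (n : nat) (c s : R) :
  is_derive s (1 : R) (fun t => c * (t ^+ n.+1 / (n.+1)`!%:R)) (c * (s ^+ n / n`!%:R)).
Proof.
have -> : (fun t => c * (t ^+ n.+1 / (n.+1)`!%:R)) =
    (c / (n.+1)`!%:R) \*: ((@id R) ^+ n.+1).
  by apply/funext => t; rewrite /= exprfctE /GRing.scale/=; ring.
apply: is_derive_eq; rewrite /GRing.scale/= mulr1 factS natrM.
have n0 : n`!%:R != 0 :> R by rewrite pnatr_eq0 -lt0n fact_gt0.
have n1 : n.+1%:R != 0 :> R by rewrite pnatr_eq0.
by move: (n.+1%:R : R) (n`!%:R : R) n1 n0 => p q p0 q0; field; rewrite p0 q0.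
Qed.

(** The one-dimensional formula: by the mean value inequality the remainder of
    u at order a is controlled by that of its Lie derivative at order a - w,
    and the orders up to w are the Hoelder condition along F itself. *)
Lemma taylor_one_field A K F w : graded A K F w -> forall M a u B,
  0 < a <= A -> a <= w * M%:R -> (hn a u <= B%:E)%E -> forall z tau,
  `|u (F tau z) -
    \sum_(n < M | w * n%:R < a) lies (nseq n F) u z * (tau ^+ n / n`!%:R)|
  <= K * B * `|tau| `^ (a / w).
Proof.
move=> [w0 Flaw Flow [K0 FK]]; elim=> [|M IH] a u B /andP[a0 aA] aM uB z tau.
  by move: aM; rewrite mulr0; lra.
rewrite big_mkcond big_ord_recl/= mulr0 a0 expr0 fact0 divr1 mulr1.
have [aw|wa] := leP a w.
  rewrite big1 ?addr0; first by apply: FK; rewrite // a0 aw.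
  move=> i _; rewrite ifF//; apply/negbTE; rewrite -leNgt /bump/= add1n.
  by rewrite -natr1 mulrDr mulr1 (le_trans aw)// lerDr mulr_ge0// ltW.
have [Fu lieB] := Flow a u B aA wa uB.
set S := \sum_(i < M) _.
have -> : S = \sum_(n < M | w * n%:R < a - w)
    lies (nseq n F) (lie F u) z * (tau ^+ n.+1 / (n.+1)`!%:R).
  rewrite big_mkcond; apply: eq_bigr => i _; rewrite /bump/= add1n.
  rewrite -natr1 mulrDr mulr1 ltrBrDr; case: ifP => // _.
  by rewrite !lies_nseq -iterSr.
pose P (s : R) := \sum_(n < M | w * n%:R < a - w)
    lies (nseq n F) (lie F u) z * (s ^+ n.+1 / (n.+1)`!%:R).
pose dP (s : R) := \sum_(n < M | w * n%:R < a - w)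
    lies (nseq n F) (lie F u) z * (s ^+ n / n`!%:R).
have dPE s : is_derive s (1 : R) P (dP s).
  rewrite /P /dP big_mkcond/=.
  rewrite (_ : (fun _ => _) = \sum_(n < M) (fun t : R => (if w * n%:R < a - w then
    lies (nseq n F) (lie F u) z else 0) * (t ^+ n.+1 / (n.+1)`!%:R))); last first.
    apply/funext => t; rewrite fct_sumE big_mkcond; apply: eq_bigr => i _.
    by case: ifP; rewrite // mul0r.
  apply: is_derive_sum => i; case: ifP => _; first exact: is_derive_monomial.
  have := is_derive_monomial i 0 s; rewrite mul0r; exact.
have dh s : is_derive s (1 : R) (fun t => u (F t z) - P t)
    (lie F u (F s z) - dP s).
  by apply: is_deriveB => //; exact: is_derive_flow.
have a1 : 0 < a - w by lra.
have := @mean_value_bound _ _ _ 0 (K * B * `|tau| `^ ((a - w) / w)) tau dh.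
have P0 : P 0 = 0 by rewrite /P big1// => i _; rewrite expr0n/= mul0r mulr0.
rewrite /= mul0r subr0 Flaw.1 -!/(P _) P0 subr0.
have -> : u (F tau z) - P tau - u z = u (F tau z) - (u z + P tau) by ring.
have -> : K * B * `|tau| `^ ((a - w) / w) * `|tau| = K * B * `|tau| `^ (a / w).
  rewrite -mulrA powRS ?divr_gt0//; congr (_ * _ `^ _).
  by field; rewrite gt_eqF.
apply=> x xtau; rewrite subr0.
have a1A : 0 < a - w <= A by rewrite a1/=; lra.
apply: le_trans (IH _ _ _ a1A _ lieB z x) _.
  by move: aM; rewrite -natr1 mulrDr mulr1; lra.
have B0 := holder_bound_ge0 uB.
rewrite ler_wpM2l ?mulr_ge0//; apply: ge0_ler_powR; rewrite ?nnegrE//.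
by rewrite ltW// divr_gt0.
Qed.

Notation step := (flow R d * R * R)%type.
Implicit Types (l : seq step) (m : seq nat).

(** Moving along several fields. A step (F, w, tau) follows the field F of
    weight w for a time tau, and a list of exponents, one for each step, plays
    the role of a multi-index. *)
Definition travel l z := foldl (fun y (s : step) => s.1.1 s.2 y) z l.

Definition word l m := flatten [seq nseq p.2 p.1.1.1 | p <- zip l m].

Definition weight l m : R := \sum_(p <- zip l m) p.1.1.2 * p.2%:R.

Definition monomial l m : R :=
  \prod_(p <- zip l m) (p.1.2 ^+ p.2 / (p.2)`!%:R).

(** All exponents below M. As soon as a <= w * M for each weight w in use, every
    multi-index of weight less than a lies in the box. *)
Fixpoint box (M k : nat) : seq (seq nat) :=
  if k is k'.+1 then [seq n :: m | m <- box M k', n <- iota 0 M] else [:: [::]].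

Lemma big_box_cons M k (P : pred (seq nat)) (G : seq nat -> R) :
  \sum_(m <- box M k.+1 | P m) G m =
  \sum_(m <- box M k) \sum_(n <- iota 0 M | P (n :: m)) G (n :: m).
Proof.
rewrite big_mkcond big_allpairs_dep.
by apply: eq_bigr => m _; rewrite [RHS]big_mkcond.
Qed.

Lemma weight_cons (s : step) l n m :
  weight (s :: l) (n :: m) = s.1.2 * n%:R + weight l m.
Proof. by rewrite /weight big_cons. Qed.

Lemma monomial_cons (s : step) l n m :
  monomial (s :: l) (n :: m) = s.2 ^+ n / n`!%:R * monomial l m.
Proof. by rewrite /monomial big_cons. Qed.

Lemma word_cons (s : step) l n m :
  word (s :: l) (n :: m) = nseq n s.1.1 ++ word l m.
Proof. by []. Qed.

Definition all_graded A K l := forall s, List.In s l -> graded A K s.1.1 s.1.2.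

Lemma all_graded_cons A K s l : all_graded A K (s :: l) ->
  graded A K s.1.1 s.1.2 /\ all_graded A K l.
Proof. by move=> sl; split=> [|r rl]; apply: sl; [left|right]. Qed.

Lemma weight_ge0 A K l m : all_graded A K l -> 0 <= weight l m.
Proof.
elim: l m => [|s l IH] [|n m]; rewrite ?/weight ?big_nil//.
move=> /all_graded_cons[[w0 _ _ _] lg]; rewrite -/(weight _ _) weight_cons.
by rewrite addr_ge0 ?IH// mulr_ge0// ltW.
Qed.

(** A word costs the sum of the weights of its letters, and the bound B is never
    increased. *)
Lemma lies_word_bound A K l m a u B : all_graded A K l -> a <= A ->
  weight l m < a -> (hn a u <= B%:E)%E ->
  lies_exist (word l m) u /\
  (hn (a - weight l m) (lies (word l m) u) <= B%:E)%E.
Proof.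
elim: l m => [|s l IH] [|n m].
1-3: by rewrite /weight /word ?big_nil/= subr0.
move=> /all_graded_cons[[w0 _ slow _] lg] aA; rewrite weight_cons word_cons.
move=> na uB; have wn : 0 <= s.1.2 * n%:R by rewrite mulr_ge0// ltW.
have m0 := weight_ge0 m lg.
have [|ex le] := IH m lg aA _ uB; first lra.
have [||nex nle] := lies_nseq_bound slow w0 _ _ le (n := n); [lra..|].
split; first exact: lies_exist_cat.
by rewrite lies_cat [X in a - X]addrC opprD addrA.
Qed.

Lemma norm_monomial_le A K l m rho : all_graded A K l -> 0 <= rho ->
  (forall s, List.In s l -> `|s.2| <= rho `^ s.1.2) ->
  `|monomial l m| <= rho `^ weight l m.
Proof.
move=> + rho0; elim: l m => [|s l IH] [|n m].
1-3: by rewrite /weight /monomial !big_nil powRr0 normr1.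
move=> /all_graded_cons[[w0 _ _ _] lg] srho.
rewrite weight_cons monomial_cons normrM.
have fact1 : 1 <= n`!%:R :> R by rewrite ler1n fact_gt0.
have -> : rho `^ (s.1.2 * n%:R + weight l m) =
    rho `^ (s.1.2 * n%:R) * rho `^ weight l m.
  by rewrite powRD_ge0 ?(weight_ge0 m lg)// mulr_ge0// ltW.
apply: ler_pM => //; last by apply: IH => // r rl; apply: srho; right.
rewrite normrM normfV normrX powRrM powR_mulrn ?powR_ge0//.
rewrite ler_pdivrMr; last by rewrite normr_gt0 gt_eqF// (lt_le_trans _ fact1).
rewrite [X in _ * X]ger0_norm ?ler0n//.
apply: le_trans (_ : (rho `^ s.1.2) ^+ n <= _).
  by rewrite lerXn2r// ?nnegrE ?powR_ge0//; apply: srho; left.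
by rewrite ler_peMr// exprn_ge0// powR_ge0.
Qed.

(** Expanding along the last field first, each coefficient is again a function
    of Hoelder class, of lower order, that is then expanded along the previous
    field. The remainder has the same order at every stage because a factor
    tau ^+ n is worth rho to the weight that was lost by differentiating. *)
Lemma taylor_along A K M l a u B rho z : all_graded A K l ->
  0 < a <= A -> (forall s, List.In s l -> a <= s.1.2 * M%:R) ->
  (hn a u <= B%:E)%E -> 0 <= rho ->
  (forall s, List.In s l -> `|s.2| <= rho `^ s.1.2) ->
  `|u (travel l z) - \sum_(m <- box M (size l) | weight l m < a)
      lies (word l m) u z * monomial l m|
  <= (\sum_(i < size l) (size (box M i))%:R) * K * B * rho `^ a.
Proof.
move=> + /andP[a0 aA] + uB rho0.
have B0 := holder_bound_ge0 uB.
elim: l z => [|s l IH] z.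
  move=> _ _ _; rewrite big_ord0 !mul0r big_cons big_nil /weight /monomial/=.
  by rewrite !big_nil a0 mulr1 addr0 subrr normr0.
move=> /all_graded_cons[sg lg] aM srho.
have := IH (s.1.1 s.2 z) lg (fun r rl => aM r (or_intror rl))
  (fun r rl => srho r (or_intror rl)).
have [w0 _ _ [K0 _]] := sg.
set S1 := \sum_(m <- _ | _) _; rewrite [size (s :: l)]/= big_box_cons big_ord_recr.
set S2 := \sum_(m <- _) _ => le1.
suff le2 : `|S1 - S2| <= (size (box M (size l)))%:R * K * B * rho `^ a.
  have := ler_distD S1 (u (travel l (s.1.1 s.2 z))) S2; rewrite !mulrDl; lra.
rewrite /S1 /S2 [in X in X - _]big_mkcond -sumrB.
have -> : (size (box M (size l)))%:R * K * B * rho `^ a =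
    \sum_(m <- box M (size l)) K * B * rho `^ a.
  by rewrite big_const_seq count_predT iter_addr_0 -[RHS]mulr_natl !mulrA.
apply: le_trans (ler_norm_sum _ _ _) _; apply: ler_sum => m _.
have KBr : 0 <= K * B * rho `^ a by rewrite !mulr_ge0 ?powR_ge0.
have [ma|am] := ltP (weight l m) a; last first.
  rewrite big1_seq ?subr0 ?normr0// => n /andP[+ _].
  rewrite weight_cons ltNge => /negP[]; rewrite (le_trans am)// lerDr.
  by rewrite mulr_ge0// ltW.
have m0 := weight_ge0 m lg.
have [_ le] := lies_word_bound lg aA ma uB.
have am0 : 0 < a - weight l m <= A by lra.
have := @taylor_one_field A K _ _ sg M _ _ _ am0 _ le z s.2.
rewrite -(big_mkord (fun n => s.1.2 * n%:R < a - weight l m)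
  (fun n => lies (nseq n s.1.1) (lies (word l m) u) z * (s.2 ^+ n / n`!%:R))).
rewrite /index_iota subn0.
set T1 := \sum_(n <- _ | _) _; set T2 := \sum_(n <- _ | _) _.
have -> : T2 = T1 * monomial l m.
  rewrite mulr_suml; apply: eq_big => n; first by rewrite weight_cons ltrBrDr.
  by move=> _; rewrite word_cons lies_cat monomial_cons mulrA.
move=> H; rewrite -mulrBl normrM.
have mono_le := norm_monomial_le m lg rho0 (fun r rl => srho r (or_intror rl)).
apply: le_trans (ler_pM _ _ (H _) mono_le) _ => //.
  by have := aM s (or_introl erefl); lra.
rewrite -(mulrA (K * B)) ler_wpM2l ?mulr_ge0//.
have {2}-> : a = (a - weight l m) + weight l m by rewrite subrK.
rewrite powRD_ge0//; last lra.
rewrite ler_wpM2r ?powR_ge0//.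
have -> : rho `^ (a - weight l m) = (rho `^ s.1.2) `^ ((a - weight l m) / s.1.2).
  by rewrite -powRrM mulrC divfK// gt_eqF.
apply: ge0_ler_powR; rewrite ?nnegrE ?powR_ge0//.
  by rewrite divr_ge0// ?(ltW w0)//; lra.
by apply: srho; left.
Qed.

End Graded.

(** * Increments along x *)

Section Commutator.
Variables (R : realType) (d : nat) (theta : R).
Hypothesis theta0 : 0 < theta.
Implicit Types (u : spacetime R d -> R) (z : spacetime R d) (i : 'I_d).
Implicit Types (A K B a w rho r s : R).
Local Notation hn := (holder_norm theta).

Lemma graded_flowY A : graded theta A 1 (@flowY R d) theta.
Proof.
split=> //; first exact: flow_lawY.
  move=> a u B _ ta uB; apply: norm_lie_finite.
  exact: le_trans (norm_lieY_le theta0 u ta) uB.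
split=> // a u B aw uB z tau; rewrite mul1r.
apply: curve_seminorm_bound; first exact: flow_lawY.
  by case/andP: aw => a0 _; exact: divr_gt0.
exact: le_trans (normY_le theta0 u aw) uB.
Qed.

Lemma graded_flowZ A i : graded theta A 1 (@flowZ R d i) 1.
Proof.
split=> //; first exact: flow_lawZ.
  move=> a u B _ ta uB; apply: norm_lie_finite.
  exact: le_trans (norm_lieZ_le theta0 u i ta) uB.
split=> // a u B aw uB z tau; rewrite mul1r divr1.
apply: curve_seminorm_bound; first exact: flow_lawZ.
  by case/andP: aw.
exact: le_trans (normZ_le theta0 u i aw) uB.
Qed.

Lemma flowZYX i r s z :
  flowZ i s (flowY r (flowX i (r * s) z)) = flowY r (flowZ i s z).
Proof.
case: z => [[t x] v] /=; congr (_, _, _).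
by apply/rowP => j; rewrite !mxE; ring.
Qed.

Lemma flowZ_commute i r s q z :
  flowZ i q (flowY r (flowX i (r * s) z)) =
  flowX i (r * (s - q)) (flowY r (flowZ i q z)).
Proof.
case: z => [[t x] v] /=; congr (_, _, _).
by apply/rowP => j; rewrite !mxE; ring.
Qed.

Lemma flowY_commute i r s q z :
  flowY q (flowZ i s z) =
  flowZ i s (flowX i ((q - r) * s) (flowY q (flowX i (r * s) z))).
Proof.
case: z => [[t x] v] /=; congr (_, _, _).
by apply/rowP => j; rewrite !mxE; ring.
Qed.

Lemma increment_diff (F : flow R d) u p q (c E s : R) : flow_law F ->
  lie_derivable F u ->
  (forall x, `|x| <= `|s| -> `|lie F u (F x p) - lie F u (F x q) - c| <= E) ->
  `|(u (F s p) - u p) - (u (F s q) - u q) - c * s| <= E * `|s|.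
Proof.
move=> Flaw Fu bnd.
have dh x : is_derive x (1 : R) (fun t => u (F t p) - u (F t q))
    (lie F u (F x p) - lie F u (F x q)).
  by apply: is_deriveB; exact: is_derive_flow.
have := mean_value_bound dh bnd; rewrite !Flaw.1.
by congr (`|_| <= _); ring.
Qed.

(** The bracket of Y and Z_i is the translation along x_i: going round a
    parallelogram of sides s along Z_i and r along Y leaves a gap r * s in the
    direction x_i, so that increments along x_i are differences of increments
    along the two given fields. *)
Lemma commutator_increment i u z r s (cZ cY EZ EY : R) :
  let z4 := flowX i (r * s) z in
  `|(u (flowZ i s z) - u z) -
    (u (flowZ i s (flowY r z4)) - u (flowY r z4)) - cZ * s| <= EZ ->
  `|(u (flowY r (flowZ i s z)) - u (flowZ i s z)) -
    (u (flowY r z4) - u z4) - cY * r| <= EY ->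
  `|u z4 - u z - (cZ * s + cY * r)| <= EZ + EY.
Proof.
move=> z4; rewrite flowZYX => hZ hY.
apply: le_trans (lerD hZ hY); apply: le_trans (ler_normD _ _).
by rewrite le_eqVlt; apply/orP; left; apply/eqP; congr (`|_|); ring.
Qed.

(** The sides of the parallelogram, rho along Z_i and r along Y, both have
    homogeneous size rho. The last equation turns powers of the time spent along
    x_i into powers of rho. *)
Lemma parabolic_split (tau : R) : tau != 0 -> exists rho r : R,
  [/\ 0 < rho, `|r| = rho `^ theta, r * rho = tau &
      forall a, `|tau| `^ (a / (1 + theta)) = rho `^ a].
Proof.
move=> tau0; pose rho := `|tau| `^ (1 + theta)^-1; exists rho, (tau / rho).
have rho0 : 0 < rho by rewrite powR_gt0// normr_gt0.
split=> //; [|by rewrite divfK// gt_eqF|by move=> a; rewrite -powRrM mulrC].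
rewrite normrM normfV (gtr0_norm rho0).
apply: (mulIf (lt0r_neq0 rho0)); rewrite divfK ?gt_eqF// powRS ?(ltW rho0)//.
have w0 : theta + 1 != 0 by rewrite gt_eqF// addr_gt0.
by rewrite -powRrM addrC mulVf// powRr1.
Qed.

(** Opposite sides of the parallelogram differ by a move of homogeneous size
    rho. An increment along Z_i is at most B * rho ^ a if a <= 1; otherwise the
    mean value theorem replaces u by Z_i u, of order a - 1 <= theta, which is
    compared at the two sides by means of a move along Y and one along x_i. The
    increments along Y are treated in the same way with Y u, of order
    a - theta <= 1, and a move along Z_i in place of the one along Y. *)
Lemma curve_holder_flowX : exists2 K : R, 0 <= K &
  forall i, curve_holder theta K (@flowX R d i) (1 + theta).
Proof.
pose mu := Num.min 1 theta.
have [mu0 [mu1 mut]] : 0 < mu /\ mu <= 1 /\ mu <= theta.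
  by rewrite lt_min ltr01 theta0 /mu !ge_min !lexx orbT.
suff claim n : exists2 K : R, 0 <= K & forall i a u B, 0 < a <= 1 + theta ->
    a <= n%:R * mu -> (hn a u <= B%:E)%E ->
    forall z tau, `|u (flowX i tau z) - u z| <= K * B * `|tau| `^ (a / (1 + theta)).
  have [K K0 H] := claim (Num.truncn ((1 + theta) / mu)).+1.
  exists K => // i a u B aw; apply: H => //.
  case/andP: aw => _ /le_trans; apply.
  by rewrite -ler_pdivrMr// ltW// truncnS_gt.
elim: n => [|n [K K0 IH]].
  by exists 0 => // i a u B /andP[a0 _]; rewrite mul0r leNgt a0.
(* One summand for each pair of opposite sides. *)
exists ((2 * K + 2) + (2 * K + 2)); first by lra.
move=> i a u B /andP[a0 aw] an uB z tau.
have B0 := holder_bound_ge0 uB.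
have [->|tau0] := eqVneq tau 0.
  have [-> _] := flow_lawX R i; rewrite subrr normr0.
  by rewrite !mulr_ge0 ?powR_ge0//; lra.
have [rho [r [rho0 r_rho rtau ->]]] := parabolic_split tau0.
have an1 : a - mu <= n%:R * mu by move: an; rewrite -natr1 mulrDl mul1r; lra.
(* The mean value theorem yields points at a time x with |x| <= rho, so that
   the remaining move along x_i takes a time of up to 2 * rho ^ (1 + theta). *)
have shift2 (b y : R) : 0 < b <= 1 + theta -> `|y| <= 2 * rho `^ (1 + theta) ->
    `|y| `^ (b / (1 + theta)) <= 2 * rho `^ b.
  move=> /andP[b0 bw] yle.
  have e1 : b / (1 + theta) <= 1 by rewrite ler_pdivrMr; lra.
  have e0 : 0 < b / (1 + theta) by rewrite divr_gt0//; lra.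
  apply: (@le_trans _ _ ((2 * rho `^ (1 + theta)) `^ (b / (1 + theta)))).
    apply: ge0_ler_powR; rewrite ?nnegrE ?(ltW e0)//.
    by rewrite mulr_ge0// powR_ge0.
  rewrite powRM ?powR_ge0// -powRrM [(1 + theta) * _]mulrC divfK; last by rewrite gt_eqF//; lra.
  by rewrite ler_wpM2r ?powR_ge0// ler1_powR//; lra.
have rhoS (b : R) : 0 < b -> rho `^ b * rho = rho `^ (b + 1).
  by apply: powRS; exact: ltW.
have rho1 : rho * rho `^ theta = rho `^ (1 + theta) by rewrite mulrC rhoS// addrC.
have := @commutator_increment i u z r rho 0 0
  ((2 * K + 2) * B * rho `^ a) ((2 * K + 2) * B * rho `^ a).
rewrite /= rtau !mul0r !addr0 !subr0 -!mulrDl; apply; set z4 := flowX i tau z.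
- have [a1|a1] := leP a 1.
    have [_ _ _ [_ FH]] := graded_flowZ a i.
    have := FH a u B _ uB; rewrite a0 a1 => /(_ isT) {}FH.
    have := FH z rho; have := FH (flowY r z4) rho; rewrite divr1 (gtr0_norm rho0).
    set p := _ - _; set q := _ - _; rewrite mul1r => hp hq.
    apply: le_trans (ler_normB _ _) _.
    have : 0 <= 2 * K * B * rho `^ a by rewrite !mulr_ge0 ?powR_ge0.
    lra.
  have [_ law low _] := graded_flowZ a i.
  have [Zu ZuB] := low a u B (lexx _) a1 uB.
  have b0 : 0 < a - 1 <= theta by lra.
  have := @increment_diff (flowZ i) u z (flowY r z4) 0
    ((2 * K + 1) * B * rho `^ (a - 1)) rho law Zu.
  rewrite mul0r subr0 (gtr0_norm rho0) => H; apply: le_trans (H _) _; last first.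
    rewrite -mulrA rhoS ?subrK; last lra.
    by rewrite ler_wpM2r ?powR_ge0// ler_wpM2r//; lra.
  move=> x xrho; rewrite subr0 /z4 -rtau flowZ_commute distrC.
  set p := flowZ i x z.
  apply: le_trans (ler_distD (lie (flowZ i) u (flowY r p)) _ _) _.
  have [_ _ _ [_ FH]] := graded_flowY a.
  have := FH _ _ _ b0 ZuB p r; rewrite mul1r r_rho -powRrM [theta * _]mulrC divfK ?gt_eqF//.
  have b1 : 0 < a - 1 <= 1 + theta by lra.
  have b2 : a - 1 <= n%:R * mu by lra.
  have := IH i _ _ _ b1 b2 ZuB (flowY r p) (r * (rho - x)).
  have : `|r * (rho - x)| <= 2 * rho `^ (1 + theta).
    rewrite normrM r_rho -rho1 [2 * _]mulrA mulrC ler_wpM2r ?powR_ge0//.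
    by have := ler_normB rho x; rewrite (gtr0_norm rho0); lra.
  move=> /(shift2 _ _ b1) h1 h2 h3.
  have : K * B * `|r * (rho - x)| `^ ((a - 1) / (1 + theta)) <= K * B * (2 * rho `^ (a - 1)).
    by rewrite ler_wpM2l// mulr_ge0.
  lra.
have [a1|a1] := leP a theta.
  have [_ _ _ [_ FH]] := graded_flowY a.
  have := FH a u B _ uB; rewrite a0 a1 => /(_ isT) {}FH.
  have := FH (flowZ i rho z) r; have := FH z4 r.
  rewrite r_rho -powRrM [theta * _]mulrC divfK ?gt_eqF//.
  set p := _ - _; set q := _ - _; rewrite mul1r => hp hq.
  apply: le_trans (ler_normB _ _) _.
  have : 0 <= 2 * K * B * rho `^ a by rewrite !mulr_ge0 ?powR_ge0.
  lra.
have [_ law low _] := graded_flowY a.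
have [Yu YuB] := low a u B (lexx _) a1 uB.
have b0 : 0 < a - theta <= 1 by lra.
have := @increment_diff flowY u (flowZ i rho z) z4 0
  ((2 * K + 1) * B * rho `^ (a - theta)) r law Yu.
rewrite mul0r subr0 r_rho => H; apply: le_trans (H _) _; last first.
  rewrite -mulrA -powRD_ge0 ?subrK ?(ltW theta0)//; last lra.
  by rewrite ler_wpM2r ?powR_ge0// ler_wpM2r//; lra.
move=> x xrho; rewrite subr0 (flowY_commute i r) rtau -/z4.
set p := flowY x z4.
apply: le_trans (ler_distD (lie flowY u (flowX i ((x - r) * rho) p)) _ _) _.
have [_ _ _ [_ FH]] := graded_flowZ a i.
have := FH _ _ _ b0 YuB (flowX i ((x - r) * rho) p) rho; rewrite mul1r (gtr0_norm rho0) divr1.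
have b1 : 0 < a - theta <= 1 + theta by lra.
have b2 : a - theta <= n%:R * mu by lra.
have := IH i _ _ _ b1 b2 YuB p ((x - r) * rho).
have : `|(x - r) * rho| <= 2 * rho `^ (1 + theta).
  rewrite normrM (gtr0_norm rho0) -rho1 mulrCA mulrC ler_wpM2l ?(ltW rho0)//.
  by have := ler_normB x r; rewrite r_rho; lra.
move=> /(shift2 _ _ b1) h1 h2 h3.
have : K * B * `|(x - r) * rho| `^ ((a - theta) / (1 + theta)) <= K * B * (2 * rho `^ (a - theta)).
  by rewrite ler_wpM2l// mulr_ge0.
lra.
Qed.

End Commutator.

(** * Comparing Taylor expansions at two points of an orbit *)

Section Bracket.
Variables (R : realType) (d : nat) (theta : R).
Hypothesis theta0 : 0 < theta.
Implicit Types (u f : spacetime R d -> R) (z : spacetime R d) (i : 'I_d).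
Implicit Types (A K B a b e rho r s y : R) (m : seq nat).
Local Notation hn := (holder_norm theta).

Lemma graded_mono A K K' (F : flow R d) w : K <= K' ->
  graded theta A K F w -> graded theta A K' F w.
Proof.
move=> KK [w0 law low [K0 FK]]; split=> //; split; first exact: le_trans KK.
move=> a u B aw uB z tau; apply: le_trans (FK a u B aw uB z tau) _.
by rewrite -!mulrA ler_wpM2r// mulr_ge0 ?powR_ge0// (holder_bound_ge0 uB).
Qed.

Lemma box_size M k m : m \in box M k -> size m = k.
Proof.
elim: k m => [|k IH] m; first by rewrite inE => /eqP ->.
by move=> /allpairsP[[m' n] [/= /IH mk _ ->]] /=; rewrite mk.
Qed.

Lemma box_uniq M k : uniq (box M k).
Proof.
elim: k => [|k IH] //; apply: allpairs_uniq => //; first exact: iota_uniq.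
by move=> [m n] [m' n'] _ _ /= [-> ->].
Qed.

Lemma mem_box M k m : (m \in box M k) = (size m == k) && all (ltn^~ M) m.
Proof.
elim: k m => [|k IH] m; first by rewrite inE; case: m.
case: m => [|n m]; first by apply/negbTE/allpairsP => -[[m' n] []].
rewrite [all _ _]/= [size _]/=.
rewrite eqSS andbCA -IH; apply/allpairsP/andP.
  move=> [[m' n'] [/= m'b n'M [-> ->]]].
  by move: n'M; rewrite mem_iota.
by move=> [nM mb]; exists (m, n); split=> //=; rewrite mem_iota.
Qed.

Definition bracket_steps i (s x y : R) :=
  [:: (@flowY R d, theta, s); (@flowZ R d i, 1, x); (@flowX R d i, 1 + theta, y)].

Local Notation word0 i := (word (bracket_steps i 0 0 0)).
Local Notation weight0 i := (weight (bracket_steps i 0 0 0)).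

Lemma word_bracket i s x y m : word (bracket_steps i s x y) m = word0 i m.
Proof. by case: m => [|k [|j [|c m]]]. Qed.

Lemma weight_bracket i s x y m : weight (bracket_steps i s x y) m = weight0 i m.
Proof. by case: m => [|k [|j [|c m]]]; rewrite /weight/= !(big_cons, big_nil). Qed.

Definition in_cylinder (rho s x y : R) :=
  [/\ `|s| <= rho `^ theta, `|x| <= rho & `|y| <= rho `^ (1 + theta)].

(** The two expansions have the same base point z, hence the same coefficients:
    only differences of monomials remain, and those of weight at least e go into
    the error because rho <= 1. *)
Lemma expansion_difference i A K M b f B z (m0 : seq nat) e :
  (forall s x y, all_graded theta A K (bracket_steps i s x y)) ->
  0 < b <= A -> b <= Num.min 1 theta * M%:R -> (hn b f <= B%:E)%E ->
  m0 \in box M 3 -> weight0 i m0 < b -> e <= b ->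
  exists C : R, forall rho s x y s' x' y' : R, 0 < rho <= 1 ->
    in_cylinder rho s x y -> in_cylinder rho s' x' y' ->
    let mono := monomial (bracket_steps i s x y) in
    let mono' := monomial (bracket_steps i s' x' y') in
    (forall m, m \in box M 3 -> m != m0 -> mono m = mono' m \/ e <= weight0 i m) ->
    `|f (flowX i y (flowZ i x (flowY s z))) -
      f (flowX i y' (flowZ i x' (flowY s' z))) -
      lies (word0 i m0) f z * (mono m0 - mono' m0)| <= C * rho `^ e.
Proof.
move=> gr b0A bM fB m0M m0b eb; have /andP[b0 _] := b0A.
have B0 := holder_bound_ge0 fB.
pose CT := (\sum_(j < 3) (size (box M j))%:R) * K * B : R.
pose CS := \sum_(m <- box M 3) 2 * `|lies (word0 i m) f z|.
exists (CT + CT + CS) => rho s x y s' x' y' /andP[rho0 rho1] cyl cyl' mono mono'.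
move=> mono_diff.
have rhoe p : e <= p -> rho `^ p <= rho `^ e by apply: ger_powR; rewrite rho0.
have times s1 x1 y1 : in_cylinder rho s1 x1 y1 ->
    forall S, List.In S (bracket_steps i s1 x1 y1) -> `|S.2| <= rho `^ S.1.2.
  by move=> [hs hx hy] S /= [<-|[<-|[<-|[]]]] //=; rewrite powRr1// ltW.
have weights s1 x1 y1 S : List.In S (bracket_steps i s1 x1 y1) -> b <= S.1.2 * M%:R.
  move=> H; apply: le_trans bM _; rewrite ler_wpM2r//.
  have [m1 mt] : Num.min 1 theta <= 1 /\ Num.min 1 theta <= theta.
    by rewrite !ge_min !lexx orbT.
  by move: H => /= [<-|[<-|[<-|[]]]] /=; lra.
have taylor s1 x1 y1 := @taylor_along _ _ _ A K M _ b f B rho z (gr s1 x1 y1) b0A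
  (weights s1 x1 y1) fB (ltW rho0).
have := taylor _ _ _ (times _ _ _ cyl); have := taylor _ _ _ (times _ _ _ cyl').
rewrite -/CT -/mono -/mono' [travel _ _]/= [travel (bracket_steps i s x y) _]/=.
under eq_bigl do rewrite weight_bracket.
under eq_bigr do rewrite word_bracket.
under [in X in _ -> X]eq_bigl do rewrite weight_bracket.
under [in X in _ -> X]eq_bigr do rewrite word_bracket.
set S' := \sum_(m <- _ | _) _; set S := \sum_(m <- _ | _) _ => h' h.
have [_ _ _ [K0 _]] := gr 0 0 0 _ (or_introl erefl).
have CT0 : 0 <= CT by rewrite !mulr_ge0// sumr_ge0.
have CTe : CT * rho `^ b <= CT * rho `^ e by rewrite ler_wpM2l// rhoe.
have le := le_trans h CTe; have le' := le_trans h' CTe; clear h h' CTe.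
suff : `|S - S' - lies (word0 i m0) f z * (mono m0 - mono' m0)| <= CS * rho `^ e.
  set T := lies _ _ _ * _ => leT.
  set p := f _ in le *; set p' := f _ in le' *.
  have -> : p - p' - T = (p - S) - (p' - S') + (S - S' - T) by ring.
  apply: le_trans (ler_normD _ _) _.
  by have := ler_normB (p - S) (p' - S'); rewrite !mulrDl; lra.
have -> : S - S' = \sum_(m <- box M 3) (if weight0 i m < b then
    lies (word0 i m) f z * (mono m - mono' m) else 0).
  rewrite /S /S' [X in X - _]big_mkcond [X in _ - X]big_mkcond -sumrB.
  by apply: eq_bigr => m _; case: ifP; rewrite ?subrr ?mulrBr.
rewrite (bigD1_seq m0) ?box_uniq// m0b addrC addrA addNr add0r.
apply: le_trans (ler_norm_sum _ _ _) _; rewrite /CS mulr_suml.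
rewrite [X in _ <= X](bigD1_seq m0) ?box_uniq//.
rewrite -[X in X <= _]add0r; apply: lerD; first by rewrite !mulr_ge0 ?powR_ge0.
rewrite [X in X <= _]big_seq_cond [X in _ <= X]big_seq_cond.
apply: ler_sum => m /andP[mb mm0].
have L0 : 0 <= 2 * `|lies (word0 i m) f z| * rho `^ e by rewrite !mulr_ge0 ?powR_ge0.
case: ifP => _; last by rewrite normr0.
have [->|em] := mono_diff m mb mm0; first by rewrite subrr mulr0 normr0.
rewrite normrM -mulrA mulrCA ler_wpM2l//.
have mle s1 x1 y1 : in_cylinder rho s1 x1 y1 ->
    `|monomial (bracket_steps i s1 x1 y1) m| <= rho `^ e.
  move=> /times cy; have := norm_monomial_le m (gr s1 x1 y1) (ltW rho0) cy.
  by rewrite weight_bracket => /le_trans; apply; exact: rhoe.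
have := mle _ _ _ cyl; have := mle _ _ _ cyl'; rewrite -/mono -/mono'.
by have := ler_normB (mono m) (mono' m); lra.
Qed.

Lemma monomial_bracket i s x y k j c :
  monomial (bracket_steps i s x y) [:: k; j; c] =
  s ^+ k / k`!%:R * (x ^+ j / j`!%:R * (y ^+ c / c`!%:R)).
Proof. by rewrite /monomial/= !(big_cons, big_nil) /= mulr1. Qed.

Lemma weight_bracketE i k j c :
  weight0 i [:: k; j; c] = theta * k%:R + j%:R + (1 + theta) * c%:R.
Proof. by rewrite /weight/= !(big_cons, big_nil) /= mul1r addr0 addrA. Qed.

Lemma box3P M m : m \in box M 3 -> exists k j c, m = [:: k; j; c].
Proof. by move/box_size; case: m => [|k [|j [|c [|]]]]//; exists k, j, c. Qed.

Lemma graded_bracket A K i : 1 <= K -> graded theta A K (@flowX R d i) (1 + theta) ->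
  forall s x y, all_graded theta A K (bracket_steps i s x y).
Proof.
move=> K1 gX s x y S /= [<-|[<-|[<-|[]]]] //=.
  by apply: (graded_mono K1); exact: graded_flowY.
by apply: (graded_mono K1); exact: graded_flowZ.
Qed.

(** Homogeneous degrees have gaps: above the degree of the monomial that is kept,
    every monomial that involves the increment lies at least min(1, theta)
    higher. *)
Lemma weight_gap (k j c : nat) : let mu := Num.min 1 theta in
  let w := theta * k%:R + j%:R + (1 + theta) * c%:R in
  ([:: k; j; c] != [:: 1; 0; 0] -> (k = 0 /\ c = 0) \/ theta + mu <= w) /\
  ([:: k; j; c] != [:: 0; 1; 0] -> (j = 0 /\ c = 0) \/ 1 + mu <= w).
Proof.
move=> mu w; have [m1 mt] : mu <= 1 /\ mu <= theta by rewrite !ge_min !lexx orbT.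
have tge p (n : nat) : (p <= n)%N -> theta * p%:R <= theta * n%:R.
  by move=> pn; rewrite ler_wpM2l ?ler_nat// ltW.
have nge p (n : nat) : (p <= n)%N -> p%:R <= n%:R :> R by rewrite ler_nat.
have := (tge 0 k isT, nge 0 j isT, tge 0 c isT) => -[[k0 j0] c0].
have wE : w = theta * k%:R + j%:R + c%:R + theta * c%:R by rewrite /w; ring.
rewrite wE; case: c c0 {w wE} => [|c] c0; last first.
  by have := (nge 1 c.+1 isT, tge 1 c.+1 isT) => -[c1 tc1]; split=> _; right; lra.
split.
  case: k k0 => [|[|k]] k0; [by left| |].
    case: j j0 => [|j] j0 //= _; right; have := nge 1 j.+1 isT; lra.
  by move=> _; right; have := tge 2 k.+2 isT; lra.
case: j j0 => [|[|j]] j0; [by left| |].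
  case: k k0 => [|k] k0 //= _; right; have := tge 1 k.+1 isT; lra.
by move=> _; right; have := nge 2 j.+2 isT; lra.
Qed.

End Bracket.

(** * The derivative along x as a bracket *)

Section SpaceDerivative.
Variables (R : realType) (d : nat) (theta : R).
Hypothesis theta0 : 0 < theta.
Implicit Types (u f : spacetime R d -> R) (z : spacetime R d) (i : 'I_d).
Implicit Types (A K B a b e rho r s y : R).
Local Notation hn := (holder_norm theta).
Local Notation w := (1 + theta).
Local Notation mu := (Num.min 1 theta).

Lemma flowX_commute i q r y z :
  flowZ i q (flowY r (flowX i y z)) = flowX i y (flowZ i q (flowY r z)).
Proof.
case: z => [[t x] v] /=; congr (_, _, _).
by apply/rowP => j; rewrite !mxE; ring.
Qed.

Lemma flowYX_commute i r y z : flowY r (flowX i y z) = flowX i y (flowY r z).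
Proof. by have := flowX_commute i 0 r y z; rewrite !(flow_lawZ R i).1. Qed.

Lemma flowYZ_commute i q s z :
  flowY q (flowZ i s z) = flowX i (q * s) (flowZ i s (flowY q z)).
Proof.
case: z => [[t x] v] /=; congr (_, _, _).
by apply/rowP => j; rewrite !mxE; ring.
Qed.

Lemma monomial_bracketY i s x y :
  monomial (bracket_steps theta i s x y) [:: 1; 0; 0]%N = s.
Proof. by rewrite monomial_bracket !expr0 !fact0 !divr1 !mulr1. Qed.

Lemma monomial_bracketZ i s x y :
  monomial (bracket_steps theta i s x y) [:: 0; 1; 0]%N = x.
Proof. by rewrite monomial_bracket !expr0 !fact0 !divr1 !mulr1 mul1r. Qed.

(** Both pairs of increments along the sides of the parallelogram are, by the
    mean value theorem, increments of Z_i u and Y u, whose expansions of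
    orders a - 1 and a - theta isolate the two mixed derivatives. *)
Lemma is_derive_flowX i A K a u B z : 1 <= K ->
  graded theta A K (@flowX R d i) w -> a - mu <= A -> w < a ->
  (hn a u <= B%:E)%E ->
  is_derive (0 : R) (1 : R) (fun s => u (flowX i s z))
    (lie (flowZ i) (lie flowY u) z - lie flowY (lie (flowZ i) u) z).
Proof.
move=> K1 gX aA wa uB.
have [m1 mt] : mu <= 1 /\ mu <= theta by rewrite !ge_min !lexx orbT.
have mu0 : 0 < mu by rewrite lt_min ltr01.
have gr := graded_bracket theta0 K1 gX.
have [_ lawZ lowZ _] := graded_flowZ theta0 a i.
have [_ lawY lowY _] := graded_flowY d theta0 a.
have a1 : 1 < a by lra.
have at1 : theta < a by lra.
have [Zu ZuB] := lowZ a u B (lexx _) a1 uB.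
have [Yu YuB] := lowY a u B (lexx _) at1 uB.
(* The order of the total error: limited by the gap between homogeneous degrees
   and by the order a of the remainders. *)
have [E [Ew E1 Ea]] : exists E : R, [/\ w < E, E <= w + mu & E <= a].
  exists (Num.min (w + mu) a).
  by rewrite lt_min !ge_min !lexx orbT wa andbT; split=> //; lra.
(* The box must also contain the exponent 1 of the monomial that is kept. *)
pose M := (Num.truncn (a / mu)).+2.
have aM : a <= mu * M%:R.
  by rewrite mulrC -ler_pdivrMr// (le_trans (ltW (truncnS_gt _)))// ler_nat.
have inbox k j c : (k < 2)%N -> (j < 2)%N -> (c < 2)%N -> [:: k; j; c] \in box M 3.
  move=> k2 j2 c2; rewrite mem_box/= andbT /M.
  by rewrite !(leq_trans _ (isT : 2 <= M)%N)//.
have bZ : 0 < a - 1 <= A by lra.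
have bY : 0 < a - theta <= A by lra.
have bZM : a - 1 <= mu * M%:R by lra.
have bYM : a - theta <= mu * M%:R by lra.
have [|||CZ HZ] := @expansion_difference _ _ _ i A K M (a - 1) (lie (flowZ i) u) B z
  [:: 1; 0; 0]%N (E - 1) gr bZ bZM ZuB; rewrite ?weight_bracketE; [exact: inbox|lra..|].
have [|||CY HY] := @expansion_difference _ _ _ i A K M (a - theta) (lie flowY u) B z
  [:: 0; 1; 0]%N (E - theta) gr bY bYM YuB; rewrite ?weight_bracketE; [exact: inbox|lra..|].
set W := _ - _.
have e0 : 0 < E / w - 1.
  by rewrite subr_gt0 ltr_pdivlMr ?mul1r//; lra.
apply: (derivative_from_bound (C := CZ + CY) e0) => tau tau1.
have [F0 _] := flow_lawX R i; rewrite F0.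
have [->|tau0] := eqVneq tau 0.
  by rewrite F0 mulr0 !subrr normr0 mul0r mulr0.
have [rho [r [rho0 r_rho rtau rhoE]]] := parabolic_split theta0 tau0.
have rho1 : rho <= 1.
  have := rhoE 1; rewrite powRr1 ?(ltW rho0)// => <-.
  have : 0 <= 1 / w by rewrite divr_ge0//; lra.
  by move=> H; have := ge0_ler_powR H; move=> /(_ `|tau| 1); rewrite !nnegrE powR1; apply.
have rho01 : 0 < rho <= 1 by rewrite rho0.
have -> : `|tau| * `|tau| `^ (E / w - 1) = rho `^ E.
  by rewrite mulr_powRB1 ?divr_gt0//; lra.
have -> : W * tau = - r * lie flowY (lie (flowZ i) u) z * rho +
    rho * lie (flowZ i) (lie flowY u) z * r.
  rewrite -rtau /W.
  by move: (lie (flowZ i) _ z) (lie flowY _ z) => p q; ring.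
have rhow : rho `^ w = rho `^ theta * rho by rewrite [w]addrC powRS// ltW.
have -> : (CZ + CY) * rho `^ E = CZ * rho `^ (E - 1) * rho + CY * rho `^ (E - theta) * rho `^ theta.
  rewrite -!mulrA powRS ?subrK ?(ltW rho0)//; last lra.
  by rewrite -powRD_ge0 ?subrK ?mulrDl// ?(ltW theta0)//; lra.
have gap k j c := @weight_gap _ _ theta0 k j c.
rewrite -{1}rtau.
apply: commutator_increment.
  have := @increment_diff _ _ (flowZ i) u z (flowY r (flowX i (r * rho) z))
    (- r * lie flowY (lie (flowZ i) u) z) (CZ * rho `^ (E - 1)) rho lawZ Zu.
  rewrite (gtr0_norm rho0); apply=> x xrho.
  have cyl : in_cylinder theta rho r x (r * rho).
    by split; rewrite ?r_rho// normrM r_rho (gtr0_norm rho0) rhow.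
  have cyl' : in_cylinder theta rho 0 x 0.
    by split; rewrite ?normr0 ?powR_ge0.
  have := HZ _ _ _ _ _ _ _ rho01 cyl cyl'; cbv zeta.
  set f := lie (flowZ i) u.
  have -> : lies (word (bracket_steps theta i 0 0 0) [:: 1; 0; 0]%N) f z =
    lie flowY f z by [].
  rewrite !monomial_bracketY flowX_commute (F0 (flowZ i x _)) lawY.1 => H.
  have flip (p q g : R) : `|q - p - - r * g| = `|p - q - g * r|.
    by rewrite -normrN; congr (`|_|); ring.
  rewrite subr0 in H; rewrite flip; apply: H => m mb m0.
  have [k [j [c mE]]] := box3P mb; rewrite mE in mb m0 *.
  rewrite !monomial_bracket weight_bracketE.
  have [[-> ->]|wge] := (gap k j c).1 m0; [left|right; lra].
  by rewrite !expr0.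
have := @increment_diff _ _ flowY u (flowZ i rho z) (flowX i (r * rho) z)
    (rho * lie (flowZ i) (lie flowY u) z) (CY * rho `^ (E - theta)) r lawY Yu.
rewrite r_rho; apply=> x xrho.
have cyl : in_cylinder theta rho x rho (x * rho).
  by split; rewrite ?(gtr0_norm rho0)// normrM (gtr0_norm rho0) rhow ler_wpM2r// ltW.
have cyl' : in_cylinder theta rho x 0 (r * rho).
  by split; rewrite ?normr0// ?(ltW rho0)// normrM r_rho (gtr0_norm rho0) rhow.
have := HY _ _ _ _ _ _ _ rho01 cyl cyl'; cbv zeta.
set f := lie flowY u.
have -> : lies (word (bracket_steps theta i 0 0 0) [:: 0; 1; 0]%N) f z =
  lie (flowZ i) f z by [].
rewrite !monomial_bracketZ flowYX_commute flowYZ_commute lawZ.1 => H.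
rewrite subr0 [lie _ _ _ * _]mulrC in H; apply: H => m mb m0.
have [k [j [c mE]]] := box3P mb; rewrite mE in mb m0 *.
rewrite !monomial_bracket weight_bracketE.
have [[-> ->]|wge] := (gap k j c).2 m0; [left|right; lra].
by rewrite !expr0.
Qed.

(** The two mixed derivatives that make up the bracket are bounded by two
    distinct summands of the seminorm, hence their difference by the seminorm
    itself. The induction is possible because the existence of the derivative at
    order a rests on expansions of order at most a - min(1, theta). *)
Lemma lowers_flowX A i : lowers theta A (@flowX R d i) w.
Proof.
have [m1 mt] : mu <= 1 /\ mu <= theta by rewrite !ge_min !lexx orbT.
have mu0 : 0 < mu by rewrite lt_min ltr01.
have [K K0 FK] := curve_holder_flowX d theta0.
suff claim n : lowers theta (n%:R * mu) (@flowX R d i) w.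
  move=> a u B aA; apply: (claim (Num.truncn (A / mu)).+1).
  by rewrite (le_trans aA)// -ler_pdivrMr// ltW// truncnS_gt.
elim: n => [|n IH] a u B an wa uB; first by exfalso; move: an; rewrite mul0r; lra.
have gX : graded theta (n%:R * mu) (K + 1) (@flowX R d i) w.
  apply: (@graded_mono _ _ _ _ K); first lra.
  by split; [lra|exact: flow_lawX|exact: IH|split].
have K1 : 1 <= K + 1 by lra.
have an1 : a - mu <= n%:R * mu by move: an; rewrite -natr1 mulrDl mul1r; lra.
have [Xu ->] := is_derive_lieE (fun z => is_derive_flowX z K1 gX an1 wa uB).
split; first exact: Xu.
apply: le_trans (uB).
apply: le_trans (holder_normB _ _ _ _) _.
have a1 : 1 < a by lra.
have at1 : theta < a by lra.
apply: le_trans (norm_lieYZ_le theta0 u i a1 at1).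
have [_ _ lowZ _] := graded_flowZ theta0 a i.
have [_ _ lowY _] := graded_flowY d theta0 a.
have [Zu ZuB] := lowZ a u B (lexx _) a1 uB.
have [Yu YuB] := lowY a u B (lexx _) at1 uB.
rewrite (norm_lieT _ _ Yu) (norm_lieT _ _ Zu).
have b1 : 1 < a - theta by lra.
have b2 : theta < a - 1 by lra.
have [_ _ lowZ' _] := graded_flowZ theta0 (a - theta) i.
have [_ _ lowY' _] := graded_flowY d theta0 (a - 1).
have [ZYu _] := lowZ' _ _ _ (lexx _) b1 YuB.
have [YZu _] := lowY' _ _ _ (lexx _) b2 ZuB.
have -> : a - w = a - theta - 1 by ring.
apply: leeD.
  by rewrite -(norm_lieT _ _ ZYu); exact: norm_lieZ_le.
have -> : a - theta - 1 = a - 1 - theta by rewrite addrAC.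
by rewrite -(norm_lieT _ _ YZu); exact: norm_lieY_le.
Qed.

Lemma graded_flowX : exists2 K : R, 1 <= K &
  forall A i, graded theta A K (@flowX R d i) w.
Proof.
have [K K0 FK] := curve_holder_flowX d theta0.
exists (K + 1); first lra.
move=> A i; apply: (@graded_mono _ _ _ _ K); first lra.
by split; [exact: addr_gt0|exact: flow_lawX|exact: lowers_flowX|split].
Qed.

End SpaceDerivative.

(** * The Taylor polynomial on the whole space *)

Section Assembly.
Variables (R : realType) (d : nat) (theta : R).
Hypothesis theta0 : 0 < theta.
Local Notation hn := (holder_norm theta).
Local Notation mi := {ffun 'I_d -> nat}.
Implicit Types (s : R) (x y v w : 'rV[R]_d) (k M : nat) (g b : mi).

Lemma big_map_enum (T V : Type) (idx : V) (op : Monoid.com_law idx)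
    (h : 'I_d -> T) (G : T -> V) :
  \big[op/idx]_(p <- [seq h j | j <- enum 'I_d]) G p = \big[op/idx]_j G (h j).
Proof. by rewrite big_map big_enum. Qed.

(** Following Y, then the Z_j, then the X_j goes from z0 to z0 composed with
    (s, y, w). The order is that of the letters of [deriv_word], and it is the
    one for which no correction terms appear: a translation in v made before the
    move along Y would shift x. *)
Definition all_steps s y w : seq (flow R d * R * R) :=
  (flowY, theta, s) :: [seq (flowZ j, 1, w 0 j) | j <- enum 'I_d]
    ++ [seq (flowX j, 1 + theta, y 0 j) | j <- enum 'I_d].

Definition exponents k g b : seq nat :=
  k :: [seq b j | j <- enum 'I_d] ++ [seq g j | j <- enum 'I_d].

Lemma zip_steps s y w k g b : zip (all_steps s y w) (exponents k g b) =
  ((flowY, theta, s), k)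
  :: [seq ((flowZ j, 1, w 0 j), b j) | j <- enum 'I_d]
  ++ [seq ((flowX j, 1 + theta, y 0 j), g j) | j <- enum 'I_d].
Proof. by rewrite /= zip_cat ?size_map// !zip_map. Qed.

Lemma word_exponents s y w k g b :
  word (all_steps s y w) (exponents k g b) = deriv_word R k g b.
Proof.
rewrite /word zip_steps /= map_cat flatten_cat /deriv_word /mi_word.
by congr (_ ++ (flatten _ ++ flatten _)); rewrite -[LHS]map_comp.
Qed.

Lemma weight_exponents s y w k g b :
  weight (all_steps s y w) (exponents k g b) = hdegree theta k g b.
Proof.
rewrite /weight zip_steps big_cons big_cat !big_map_enum/= /hdegree /mi_size.
under eq_bigr do rewrite mul1r.
by rewrite -mulr_sumr -!natr_sum -addrA; congr (_ + _); rewrite addrC.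
Qed.

Lemma monomial_exponents s y w k g b :
  monomial (all_steps s y w) (exponents k g b) =
  s ^+ k * mi_pow y g * mi_pow w b / (k`! * mi_fact g * mi_fact b)%:R.
Proof.
rewrite /monomial zip_steps big_cons big_cat !big_map_enum/=.
rewrite !prodf_div -!natr_prod !natrM !invfM -/(mi_pow w b) -/(mi_pow y g).
by rewrite -/(mi_fact b) -/(mi_fact g); ring.
Qed.

Lemma travel_all_steps s y w t x v :
  travel (all_steps s y w) (t, x, v) = (t + s, x + s *: v + y, v + w).
Proof.
rewrite /travel /= foldl_cat.
have trZ (r : seq 'I_d) z : foldl (fun p S => S.1.1 S.2 p) z
    [seq (flowZ j, (1 : R), w 0 j) | j <- r] =
    (z.1.1, z.1.2, z.2 + \sum_(j <- r) w 0 j *: delta_mx 0 j).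
  elim: r z => [|j r IH] [[t' x'] v']; first by rewrite big_nil addr0.
  by rewrite /= IH/= big_cons addrA.
have trX (r : seq 'I_d) z : foldl (fun p S => S.1.1 S.2 p) z
    [seq (flowX j, 1 + theta, y 0 j) | j <- r] =
    (z.1.1, z.1.2 + \sum_(j <- r) y 0 j *: delta_mx 0 j, z.2).
  elim: r z => [|j r IH] [[t' x'] v']; first by rewrite big_nil addr0.
  by rewrite /= IH/= big_cons addrA.
by rewrite trZ trX /= !big_enum/= -!row_sum_delta.
Qed.

Lemma all_graded_steps : exists2 K : R, 1 <= K &
  forall A s y w, all_graded theta A K (all_steps s y w).
Proof.
have [K K1 gX] := graded_flowX d theta0; exists K => // A s y w S /= [<-|] /=.
  by apply: (graded_mono K1); exact: graded_flowY.
move=> Sl; have [|] := List.in_app_or _ _ _ Sl.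
  move=> /(List.in_map_iff _ _ _).1[j [<- _]].
  by apply: (graded_mono K1); exact: graded_flowZ.
by move=> /(List.in_map_iff _ _ _).1[j [<- _]]; exact: gX.
Qed.

Lemma size_all_steps s y w : size (all_steps s y w) = (d + d).+1.
Proof.
rewrite -[LHS]/((size (_ ++ _)).+1) size_cat.
by congr (_ + _).+1; rewrite size_map size_enum_ord.
Qed.

Lemma size_exponents k g b : size (exponents k g b) = (d + d).+1.
Proof.
rewrite -[LHS]/((size (_ ++ _)).+1) size_cat.
by congr (_ + _).+1; rewrite size_map size_enum_ord.
Qed.

Lemma exponents_lt M k g b : hdegree theta k g b < Num.min 1 theta * M%:R ->
  all (ltn^~ M) (exponents k g b).
Proof.
have [m1 mt] : Num.min 1 theta <= 1 /\ Num.min 1 theta <= theta.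
  by rewrite !ge_min !lexx orbT.
have mu0 : 0 < Num.min 1 theta by rewrite lt_min ltr01.
set mu := Num.min 1 theta in m1 mt mu0 *; clearbody mu.
have mul (c : R) (n : nat) : mu <= c -> mu * n%:R <= c * n%:R.
  by move=> mc; rewrite ler_wpM2r.
have mi_le (c : mi) j : (c j)%:R <= (mi_size c)%:R :> R.
  by rewrite ler_nat /mi_size (bigD1 j)//= leq_addr.
rewrite /hdegree => hlt.
have lt (n : nat) : mu * n%:R <=
    theta * k%:R + (1 + theta) * (mi_size g)%:R + (mi_size b)%:R -> (n < M)%N.
  by move=> le; rewrite -(ltr_nat R) -(ltr_pM2l mu0); apply: le_lt_trans hlt.
have := (mul theta k mt, ler0n R k, ler0n R (mi_size g), ler0n R (mi_size b)).
move=> -[[[muk k0] g0] b0].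
have tk : 0 <= theta * k%:R by rewrite mulr_ge0// ltW.
have tg : 0 <= (1 + theta) * (mi_size g)%:R by rewrite mulr_ge0//; lra.
rewrite /exponents -[all _ _]/((k < M)%N && all _ (_ ++ _)) all_cat; apply/and3P; split.
- by apply: lt; lra.
- apply/allP => _ /mapP[j _ ->]; apply: lt.
  by have := mul 1 (b j) m1; have := mi_le b j; lra.
apply/allP => _ /mapP[j _ ->]; apply: lt.
have : (1 + theta) * (g j)%:R <= (1 + theta) * (mi_size g)%:R.
  by rewrite ler_wpM2l//; lra.
have mt1 : mu <= 1 + theta by lra.
by have := mul _ (g j) mt1; lra.
Qed.

Lemma gmul_ginv (t0 t : R) x0 v0 x v :
  gmul (ginv (t0, x0, v0)) (t, x, v) = (t - t0, x - x0 - (t - t0) *: v0, v - v0).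
Proof.
rewrite /gmul /ginv /=; congr (_, _, _); last by rewrite addrC.
  by rewrite addrC.
by apply/rowP => j; rewrite !mxE; ring.
Qed.

(** The sum over the multi-indices (k, gamma, beta) is reindexed by lists of
    exponents, which is how Taylor sums along a list of fields are written. *)
Lemma taylor_box s y w M alpha (u : spacetime R d -> R) z0 z :
  alpha <= Num.min 1 theta * M%:R ->
  gmul (ginv z0) z = (s, y, w) ->
  taylor theta alpha u z0 z =
  \sum_(m <- box M (size (all_steps s y w)) | weight (all_steps s y w) m < alpha)
    lies (word (all_steps s y w) m) u z0 * monomial (all_steps s y w) m.
Proof.
move=> aM; set L := all_steps s y w.
case: z0 => [[t0 x0] v0]; case: z => [[t x] v]; rewrite gmul_ginv => -[sE yE wE].
rewrite /taylor [LHS]/= wE yE sE.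
rewrite -[RHS]big_filter [RHS]fsbig_seq; last by apply: filter_uniq; exact: box_uniq.
pose phi (m : nat * mi * mi) := exponents m.1.1 m.1.2 m.2.
set S := [seq m <- box _ _ | _].
rewrite [RHS](@reindex_fsbig _ _ _ _ _ phi
  [set m : nat * mi * mi | hdegree theta m.1.1 m.1.2 m.2 < alpha] [set` S]).
  apply: eq_fsbigr => -[[k g] b] _; rewrite /phi /L/=.
  by rewrite word_exponents monomial_exponents; ring.
split.
- move=> [[k g] b] /=; rewrite mem_filter weight_exponents => hlt.
  rewrite hlt mem_box size_all_steps size_exponents eqxx.
  by apply: exponents_lt; exact: lt_le_trans aM.
- move=> [[k g] b] [[k' g'] b'] _ _ /= [-> /eqP].
  rewrite eqseq_cat ?size_map// => /andP[/eqP/eq_in_map bb /eqP/eq_in_map gg].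
  by congr (_, _, _); apply/ffunP => j; [apply: gg | apply: bb]; rewrite mem_enum.
move=> m /=; rewrite mem_filter mem_box => /andP[mlt /andP[/eqP msize _]].
rewrite size_all_steps in msize.
case: m msize mlt => [//|k m] [msize] mlt.
have mE (m' : seq nat) : size m' = d ->
    [seq nth 0%N m' (nat_of_ord j) | j <- enum 'I_d] = m'.
  move=> m'd; rewrite (map_comp (nth 0%N m') (@nat_of_ord d)) val_enum_ord.
  by rewrite -m'd map_nth_iota0 ?take_size.
pose g : mi := [ffun j : 'I_d => nth 0%N (drop d m) j].
pose b : mi := [ffun j : 'I_d => nth 0%N (take d m) j].
have E : exponents k g b = k :: m.
  rewrite /exponents; congr (_ :: _).
  rewrite (eq_map (g := fun j : 'I_d => nth 0%N (take d m) j)); last first.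
    by move=> j; rewrite ffunE.
  rewrite [X in _ ++ X](eq_map (g := fun j : 'I_d => nth 0%N (drop d m) j)); last first.
    by move=> j; rewrite ffunE.
  have st : size (take d m) = d by rewrite size_takel// msize leq_addr.
  have sd : size (drop d m) = d by rewrite size_drop msize addnK.
  by rewrite (mE _ st) (mE _ sd) cat_take_drop.
exists (k, g, b) => //=.
by rewrite -(weight_exponents s y w) E.
Qed.

Lemma abs_le_eucl x j : `|x 0 j| <= eucl x.
Proof.
rewrite -sqrtr_sqr ler_wsqrtr// (bigD1 j)//= lerDl.
by apply: sumr_ge0 => i _; exact: sqr_ge0.
Qed.

Lemma all_steps_le s y w S : List.In S (all_steps s y w) ->
  `|S.2| <= hom_norm theta (s, y, w) `^ S.1.2.
Proof.
set rho := hom_norm _ _.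
have eu x : 0 <= eucl x by exact: sqrtr_ge0.
have w0 : 0 < theta + 1 by rewrite addr_gt0.
have rhoE : rho = `|s| `^ (1 / theta) + eucl y `^ (1 / (theta + 1)) + eucl w by [].
have := (powR_ge0 `|s| (1 / theta), powR_ge0 (eucl y) (1 / (theta + 1)), eu w).
move=> -[[s0 y0] w00].
have root (r c : R) : 0 <= r -> 0 < c -> r `^ (1 / c) <= rho -> r <= rho `^ c.
  move=> r0 c0 le; rewrite -[X in X <= _](_ : (r `^ (1 / c)) `^ c = r).
    by apply: ge0_ler_powR; rewrite ?nnegrE ?(ltW c0) ?powR_ge0//; lra.
  by rewrite -powRrM div1r mulVf ?powRr1// gt_eqF.
move=> Sl; have [<-|Sl'] := Sl.
  by apply: root => //=; rewrite rhoE; lra.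
have [|] := List.in_app_or _ _ _ Sl'.
  move=> /(List.in_map_iff _ _ _).1[j [<- _]] /=.
  apply: le_trans (abs_le_eucl w j) _.
  by rewrite powRr1 rhoE; lra.
move=> /(List.in_map_iff _ _ _).1[j [<- _]] /=.
apply: le_trans (abs_le_eucl y j) _.
by rewrite addrC; apply: root => //; rewrite rhoE; lra.
Qed.

End Assembly.

Unset Implicit Arguments.

Theorem theorem7 (R : realType) (d : nat) (theta : R) (hd : (1 <= d)%N)
    (htheta : 0 < theta) (alpha : R) (halpha : 0 < alpha) :
  (forall u : spacetime R d -> R, holder theta alpha u ->
    forall (k : nat) (gamma beta : multi_index d),
      0 <= hdegree theta k gamma beta < alpha ->
      lies_exist (deriv_word R k gamma beta) u /\
      (holder_norm theta (alpha - hdegree theta k gamma beta)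
         (lies (deriv_word R k gamma beta) u)
       <= holder_norm theta alpha u)%E) /\
  (exists2 c : R, 0 < c &
    forall u : spacetime R d -> R, holder theta alpha u ->
    forall z z0 : spacetime R d,
      (`|u z - taylor theta alpha u z0 z|%:E
       <= c%:E * holder_norm theta alpha u
          * (hom_norm theta (gmul (ginv z0) z) `^ alpha)%:E)%E).
Proof.
have [K K1 gr] := @all_graded_steps R d theta htheta.
split.
  move=> u hu k gamma beta /andP[_ deg_lt].
  have := @lies_word_bound _ _ _ _ _ _ (exponents k gamma beta) alpha u
    (fine (holder_norm theta alpha u)) (gr alpha 0 0 0) (lexx _).
  rewrite weight_exponents word_exponents fineK//.
  by apply=> //; exact: lexx.
pose M := (Num.truncn (alpha / Num.min 1 theta)).+1.
have mu0 : 0 < Num.min 1 theta by rewrite lt_min ltr01.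
have aM : alpha <= Num.min 1 theta * M%:R.
  by rewrite mulrC -ler_pdivrMr// ltW// truncnS_gt.
pose c := (\sum_(i < (d + d).+1) (size (box M i))%:R) * K : R.
have c0 : 0 <= c by rewrite mulr_ge0 ?sumr_ge0//; lra.
exists (c + 1); first lra.
move=> u hu z z0; rewrite -(fineK hu) -!EFinM lee_fin.
set B := fine _; set rho := hom_norm _ _.
have B0 : 0 <= B by rewrite fine_ge0// holder_norm_ge0.
have [[[s y] w] pE] : exists p, p = gmul (ginv z0) z by exists (gmul (ginv z0) z).
have rho0 : 0 <= rho.
  by rewrite /rho -pE /hom_norm !addr_ge0 ?powR_ge0// sqrtr_ge0.
have zE : travel (all_steps theta s y w) z0 = z.
  move: pE; case: z0 {rho rho0} => [[t0 x0] v0]; case: z => [[t x] v].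
  rewrite gmul_ginv travel_all_steps => -[-> -> ->].
  by congr (_, _, _); [ring|apply/rowP => j; rewrite !mxE; ring..].
rewrite (taylor_box htheta u aM (esym pE)) -{1}zE.
apply: (@le_trans _ _ (c * B * rho `^ alpha)); last first.
  by rewrite ler_wpM2r ?powR_ge0// ler_wpM2r//; lra.
rewrite /c -(size_all_steps theta s y w).
apply: (taylor_along z0 (gr alpha s y w)) => //.
- by rewrite halpha lexx.
- have [m1 mt] : Num.min 1 theta <= 1 /\ Num.min 1 theta <= theta.
    by rewrite !ge_min !lexx orbT.
  move=> S Sl; apply: le_trans aM _; rewrite ler_wpM2r//.
  have [<-|Sl'] := Sl; first exact: mt.
  have [|] := List.in_app_or _ _ _ Sl'.
    by move=> /(List.in_map_iff _ _ _).1[j [<- _]].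
  by move=> /(List.in_map_iff _ _ _).1[j [<- _]] /=; lra.
- by rewrite fineK// lexx.
by move=> S Sl; rewrite /rho -pE; exact: all_steps_le.
Qed.
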